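(* Let $\Phi^0$ be a homogeneous Poisson point process on $\mathbb{R}$ ($d=1$). Under the Palm probability of $\Phi^0$, the $\mathrm{CHN}^2$ Eternal Family Forest $G$ is almost surely connected.
   Context: Standing assumptions: $\Phi^0$ is a simple point process with a.s. pairwise distinct interpoint distances. For finite sets $S,T$ let $\delta(S,T)=\min_{x\in S,y\in T}|x-y|$. Graph of a point-shift $h$: vertices the points, directed edges $x\to h(x)$. $\mathrm{CHN}^2$ construction. $f^0(x)$ is the nearest neighbour of $x$. Inductively, suppose $f^{k-1}$ is defined and every connected component of its graph is finite and contains exactly one cycle, which has length $2$ (a pair $\{a,b\}$ with $f^{k-1}(a)=b$ and $f^{k-1}(b)=a$). These pairs are denoted $S^{k-1}_i$. For each pair $S^{k-1}_i$, let $S^{k-1}_j$ ($j\ne i$) minimize $\delta(S^{k-1}_i,S^{k-1}_j)$, and let $x_i\in S^{k-1}_i$, $x_j\in S^{k-1}_j$ attain the minimum; $x_i$ is the exit point of order $k-1$. Set $f^k(x_i)=x_j$ for exit points and $f^k(y)=f^{k-1}(y)$ otherwise. For the Poisson process this is a.s. well defined at all levels. For every $x$ the sequence $f^n(x)$ is a.s. eventually constant, with eventual value $f^\infty(x)$. The graph $G$ of $f^\infty$ (on the Palm version $\Phi^0\cup\{0\}$), viewed as an undirected graph, is the $\mathrm{CHN}^2$ Eternal Family Forest. *)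

(* Defs.v *)
From HB Require Import structures.
From mathcomp Require Import all_boot all_order all_algebra.
From mathcomp Require Import all_classical all_reals all_analysis.
Set Implicit Arguments. Unset Strict Implicit. Unset Printing Implicit Defensive.
Import Order.TTheory GRing.Theory Num.Theory.
Local Open Scope classical_set_scope.
Local Open Scope ring_scope.

Section Defs.
Context {R : realType}.

Definition count_is (A : set R) (n : nat) : Prop :=
  exists s : seq R, [/\ uniq s, [set x | x \in s] = A & size s = n].

Definition bounded_borel (B : set R) : Prop :=
  measurable B /\ exists M : R, B `<=` [set x | `|x| <= M].

(** Poisson probability of [k] with mean [m] (valid also for [m = 0]). *)
Definition poisson_prob (m : R) (k : nat) : R :=
  m ^+ k / k`!%:R * expR (- m).

Definition PoissonPP {d} {T : measurableType d} (P : probability T R)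
    (lam : R) (Phi : T -> set R) : Prop :=
  [/\ 0 < lam,
      (forall w (a b : R), finite_set (Phi w `&` [set x | a <= x <= b])),
      (forall (B : set R) (n : nat), bounded_borel B ->
         measurable [set w | count_is (Phi w `&` B) n]) &
      (forall (m : nat) (B : 'I_m -> set R) (n : 'I_m -> nat),
         (forall i, bounded_borel (B i)) ->
         (forall i j, i != j -> B i `&` B j = set0) ->
         P (\bigcap_(i in [set: 'I_m]) [set w | count_is (Phi w `&` B i) (n i)])
         = (\prod_(i < m) poisson_prob (lam * fine (lebesgue_measure (B i))) (n i))%:E)].

Definition ugraph_adj (S : set R) (g : R -> R) (x y : R) : Prop :=
  S x /\ S y /\ (g x = y \/ g y = x).

Definition joined (adj : R -> R -> Prop) (x y : R) : Prop :=
  exists (n : nat) (z : nat -> R),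
    [/\ z 0%N = x, z n = y & forall i, (i < n)%N -> adj (z i) (z i.+1)].

Definition component (S : set R) (g : R -> R) (x : R) : set R :=
  [set y | S y /\ joined (ugraph_adj S g) x y].

Definition periodic (g : R -> R) (y : R) : Prop :=
  exists n : nat, (0 < n)%N /\ iter n g y = y.

Definition on_2cycle (g : R -> R) (y : R) : Prop := g (g y) = y /\ g y <> y.

Definition chn_wellformed (S : set R) (g : R -> R) : Prop :=
  (forall x, S x -> S (g x)) /\
  forall x, S x ->
    finite_set (component S g x) /\
    exists a, [/\ component S g x a, on_2cycle g a &
      forall y, component S g x y -> periodic g y -> y = a \/ y = g a].

Definition cycle_points (S : set R) (g : R -> R) : set R :=
  [set y | S y /\ on_2cycle g y].

(** [x] is the exit point of its pair [{x, g x}], attaining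
    [delta({x, g x}, S_j)] for the minimizing pair [S_j], at [y] in [S_j]. *)
Definition is_exit (S : set R) (g : R -> R) (x y : R) : Prop :=
  [/\ cycle_points S g x, cycle_points S g y, y <> x, y <> g x &
      forall x' y', (x' = x \/ x' = g x) -> cycle_points S g y' ->
        y' <> x -> y' <> g x -> `|x - y| <= `|x' - y'| ].

Definition chn_step (S : set R) (g h : R -> R) : Prop :=
  (forall a, cycle_points S g a ->
     exists x y, (x = a \/ x = g a) /\ is_exit S g x y) /\
  forall x, S x ->
    (forall y, is_exit S g x y -> h x = y) /\
    ((forall y, ~ is_exit S g x y) -> h x = g x).

Definition nearest_neighbour (S : set R) (x y : R) : Prop :=
  [/\ S y, y <> x & forall z, S z -> z <> x -> `|x - y| <= `|x - z|].

Definition CHN2 (S : set R) (f : nat -> R -> R) : Prop :=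
  (forall x, S x -> nearest_neighbour S x (f 0%N x)) /\
  forall k, chn_wellformed S (f k) /\ chn_step S (f k) (f k.+1).

Definition eventual_value (f : nat -> R -> R) (x y : R) : Prop :=
  exists N, forall n, (N <= n)%N -> f n x = y.

Definition EFF_adj (S : set R) (f : nat -> R -> R) (x y : R) : Prop :=
  S x /\ S y /\ (eventual_value f x y \/ eventual_value f y x).

Definition CHN2_EFF_connected (S : set R) : Prop :=
  (exists f, CHN2 S f) /\
  forall f, CHN2 S f ->
    (forall x, S x -> exists y, eventual_value f x y) /\
    (forall x y, S x -> S y -> joined (EFF_adj S f) x y).

End Defs.

(* Main.v *)
Require Import Defs.
From HB Require Import structures.
From mathcomp Require Import all_boot all_order all_algebra.
From mathcomp Require Import all_classical all_reals all_analysis.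
From mathcomp Require Import measurable_realfun lra ring.
Import Order.TTheory GRing.Theory Num.Theory.
Local Open Scope classical_set_scope.
Local Open Scope ring_scope.

(** The 2-cycles of f^k are pairs of points forming an ordered chain of disjoint
    intervals, and the 2-cycles of f^(k+1) are exactly the gaps between
    consecutive pairs that are strict local minima of the gap length; each pair
    flows towards the smaller of its two neighbouring gaps.  If no distances are
    tied and the pairs of every level are unbounded in both directions, all the
    f^k are well defined, and two points fail to be connected in the limit only
    if some gap of S is a local maximum at every level.  Such a gap is unique,
    because the number of pairs strictly between two of them would decrease
    forever; similarly at most one point lies on a 2-cycle at every level.

    For a stationary process, a subset of the points defined in a measurable and
    shift-covariant way almost surely has neither a first nor a last element,
    since such an element would be "uniformly distributed" on the line.  Applied
    to the points preceding a small (large) gap of level k this makes all levels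
    unbounded, and applied to the two unique objects above it excludes them.

    Finally, conditioned on having one point in an interval I, the Poisson process
    has the law of the process outside I plus an independent uniform point of I.
    This shows that ties have probability zero, and that almost sure
    shift-invariant properties of the process pass to its Palm version. *)

Set Implicit Arguments.
Unset Strict Implicit.
Unset Printing Implicit Defensive.

(** * Ordered systems of pairs *)

Section PairSystems.
Context {R : realType}.
Implicit Types (S A : set R) (D : R -> R -> Prop) (g h : R -> R).

Definition locally_finite S :=
  forall a b : R, finite_set (S `&` [set x | a <= x <= b]).

Lemma finite_argmin A (phi : R -> R) :
  finite_set A -> A !=set0 -> exists2 x, A x & forall y, A y -> phi x <= phi y.
Proof.
move=> /finite_seqP[s ->]; elim: s => [[x //]|a s IH _].
have [s0|s0] := eqVneq [set` s] set0.
  exists a => [|y]; first by rewrite /= inE eqxx.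
  rewrite /= inE => /orP[/eqP ->//|ys].
  by have : [set` s] y by []; rewrite s0.
have /set0P/IH[x xs xmin] := s0.
have [le_ax|lt_xa] := leP (phi a) (phi x).
  exists a => [|y]; first by rewrite /= inE eqxx.
  rewrite /= inE => /orP[/eqP ->//|ys].
  by rewrite (le_trans le_ax)// xmin.
exists x => [|y]; first by rewrite /= inE xs orbT.
by rewrite /= inE => /orP[/eqP ->|/xmin//]; exact: ltW.
Qed.

Lemma locally_finite_min {S A} {m : R} : locally_finite S -> A `<=` S ->
  (exists2 x, A x & m < x) ->
  exists x, [/\ A x, m < x & forall y, A y -> m < y -> x <= y].
Proof.
move=> lf AS [x0 Ax0 mx0].
have [||x [Ax mx _] xmin] :=
    @finite_argmin [set x | [/\ A x, m < x & x <= x0]] id.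
- apply: sub_finite_set (lf m x0) => x /= [Ax mx xx0].
  by split; [exact: AS|rewrite (ltW mx)].
- by exists x0.
exists x; split=> // y Ay my; have [yx0|x0y] := leP y x0; first exact: xmin.
by rewrite (le_trans _ (ltW x0y))//; apply: xmin.
Qed.

Lemma locally_finite_max {S A} {m : R} : locally_finite S -> A `<=` S ->
  (exists2 x, A x & x < m) ->
  exists x, [/\ A x, x < m & forall y, A y -> y < m -> y <= x].
Proof.
move=> lf AS [x0 Ax0 mx0].
have [||x [Ax mx _] xmin] :=
    @finite_argmin [set x | [/\ A x, x < m & x0 <= x]] -%R.
- apply: sub_finite_set (lf x0 m) => x /= [Ax mx xx0].
  by split; [exact: AS|rewrite (ltW mx) xx0].
- by exists x0.
exists x; split=> // y Ay my; have [yx0|x0y] := leP x0 y.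
  by rewrite -lerN2; exact: xmin.
by rewrite (le_trans (ltW x0y))// -lerN2; apply: xmin.
Qed.

Definition no_ties S := forall x y z w, S x -> S y -> S z -> S w ->
  x < y -> y <= z -> z < w -> y - x != w - z.

Definition Gap D (r l : R) : Prop :=
  [/\ exists a, D a r, exists b, D l b, r < l &
      forall a b, D a b -> r < a -> l <= a].

Definition Step D (x y : R) : Prop :=
  [/\ Gap D x y,
      forall a r, D a x -> Gap D r a -> y - x < a - r &
      forall b l, D y b -> Gap D b l -> y - x < l - b].

Definition LocalMaxGap D (x y : R) : Prop :=
  [/\ Gap D x y,
      forall a r, D a x -> Gap D r a -> a - r < y - x &
      forall b l, D y b -> Gap D b l -> l - b < y - x].

Definition Endpt D (c : R) : Prop := exists a, D a c \/ D c a.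

Definition Exit D (x y : R) : Prop :=
  (exists a, [/\ D a x, Gap D x y & forall r, Gap D r a -> y - x < a - r]) \/
  (exists b, [/\ D x b, Gap D y x & forall l, Gap D b l -> x - y < l - b]).

Record PairSystem S D : Prop := MkSys {
  sys_in : forall a b, D a b -> [/\ S a, S b & a <= b];
  sys_dj : forall a b a' b', D a b -> D a' b' ->
    (a = a' /\ b = b') \/ b < a' \/ b' < a;
  sys_up : forall M : R, exists a b, D a b /\ M < a;
  sys_dn : forall M : R, exists a b, D a b /\ b < M }.

Section Fixed.
Variables (S : set R) (D : R -> R -> Prop).
Hypotheses (lf : locally_finite S) (nt : no_ties S) (sys : PairSystem S D).

Lemma endpt_in c : Endpt D c -> S c.
Proof. by case=> a [/(sys_in sys)[]|/(sys_in sys)[]]. Qed.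

Lemma sys_inj_r a b b' : D a b -> D a b' -> b = b'.
Proof.
move=> Dab Dab'; have [_ _ ab] := sys_in sys Dab.
have [_ _ ab'] := sys_in sys Dab'.
by have [[]//|[]] := sys_dj sys Dab Dab'; lra.
Qed.

Lemma sys_inj_l a a' b : D a b -> D a' b -> a = a'.
Proof.
move=> Dab Dab'; have [_ _ ab] := sys_in sys Dab.
have [_ _ ab'] := sys_in sys Dab'.
by have [[]//|[]] := sys_dj sys Dab Dab'; lra.
Qed.

Lemma sys_chain a x b : D a x -> D x b -> a = x /\ x = b.
Proof.
move=> Dab Dab'; have [_ _ ab] := sys_in sys Dab.
have [_ _ ab'] := sys_in sys Dab'.
by have [[]//|[]] := sys_dj sys Dab Dab'; lra.
Qed.

Lemma sys_common a b a' b' e : D a b -> D a' b' -> (e = a \/ e = b) ->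
  (e = a' \/ e = b') -> a = a' /\ b = b'.
Proof.
move=> Dab Dab'; have [_ _ ab] := sys_in sys Dab.
have [_ _ ab'] := sys_in sys Dab'.
by have [//|[h1|h1]] := sys_dj sys Dab Dab'; move=> [e1|e1] [e2|e2]; lra.
Qed.

Lemma endpt_pair c : Endpt D c -> exists a b, D a b /\ (c = a \/ c = b).
Proof.
by case=> a [Da|Da]; [exists a, c|exists c, a]; split=> //; [right|left].
Qed.

Lemma gap_next a b : D a b -> exists l, Gap D b l.
Proof.
move=> Dab; have [||l [[b' Dl] bl lmin]] :=
    @locally_finite_min S [set l | exists b', D l b'] b lf.
- by move=> l [b' /(sys_in sys)[]].
- by have [l [b' [Dl bl]]] := sys_up sys b; exists l => //; exists b'.
exists l; split=> //; [by exists a|by exists b'|].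
by move=> a1 b1 D1; apply: lmin; exists b1.
Qed.

Lemma gap_prev a b : D a b -> exists r, Gap D r a.
Proof.
move=> Dab; have [||r [[a' Dr] ra rmax]] :=
    @locally_finite_max S [set r | exists a', D a' r] a lf.
- by move=> l [b' /(sys_in sys)[]].
- by have [l [b' [Dl bl]]] := sys_dn sys a; exists b' => //; exists l.
exists r; split=> //; [by exists a'|by exists b|].
move=> a1 b1 D1 ra1; have [[->//]|[h|h]] := sys_dj sys D1 Dab.
  by have := rmax b1 (ex_intro _ a1 D1) h; have [_ _] := sys_in sys D1; lra.
by have [_ _] := sys_in sys Dab; lra.
Qed.

Lemma gap_le r l a b : Gap D r l -> D a b -> b < l -> b <= r.
Proof.
move=> [[a0 D0] [b0 Dl] rl gap] Dab bl; rewrite leNgt; apply/negP => rb.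
have [_ _ ab] := sys_in sys Dab.
have [[_]|[h|h]] := sys_dj sys D0 Dab; try lra.
  by have := gap _ _ Dab h; lra.
by have [_ _] := sys_in sys D0; lra.
Qed.

Lemma gap_ge r l a b : Gap D r l -> D a b -> r < b -> l <= a.
Proof.
move=> G Dab rb; have [[a0 D0] [b0 Dl] rl gap] := G.
have [lb|bl] := leP l b; last by have := gap_le G Dab bl; lra.
have [[<- //]|[h|h]] := sys_dj sys Dl Dab.
  by have [_ _] := sys_in sys Dl; lra.
by lra.
Qed.

Lemma gap_in r l : Gap D r l -> S r /\ S l.
Proof. by case=> [[a /(sys_in sys)[_ ? _]]] [b /(sys_in sys)[? _ _]]. Qed.

Lemma gap_endpt r l c : Gap D r l -> Endpt D c -> c <= r \/ l <= c.
Proof.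
move=> G [a [Dac|Dca]].
  have [lc|cl] := leP l c; first by right.
  by left; exact: (gap_le G Dac cl).
have [cr|rc] := leP c r; [by left|right].
by have [_ _ _] := G; apply; eauto.
Qed.

Lemma gap_inj_r r l l' : Gap D r l -> Gap D r l' -> l = l'.
Proof.
move=> [_ [b D1] rl g] [_ [b' D1'] rl' g'].
by apply/eqP; rewrite eq_le (g _ _ D1' rl') (g' _ _ D1 rl).
Qed.

Lemma gap_inj_l r r' l : Gap D r l -> Gap D r' l -> r = r'.
Proof.
move=> G G'; have [[a D1] _ rl _] := G; have [[a' D1'] _ rl' _] := G'.
apply/eqP; rewrite eq_le (gap_le G' D1 rl).
by rewrite (gap_le G D1' rl').
Qed.

Lemma gap_neq r a b l : Gap D r a -> D a b -> Gap D b l -> a - r != l - b.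
Proof.
move=> G Dab G'; have [Sr _] := gap_in G; have [_ Sl] := gap_in G'.
have [Sa Sb ab] := sys_in sys Dab.
by apply: nt => //; [case: G|case: G'].
Qed.

Lemma ex_cases a b : D a b ->
  (exists l, Gap D b l /\ Exit D b l) \/ (exists r, Gap D r a /\ Exit D a r).
Proof.
move=> Dab; have [l Gl] := gap_next Dab; have [r Gr] := gap_prev Dab.
have := gap_neq Gr Dab Gl; rewrite neq_lt => /orP[h|h].
  right; exists r; split=> //; right; exists b; split=> // l' Gl'.
  by rewrite (gap_inj_r Gl' Gl).
left; exists l; split=> //; left; exists a; split=> // r' Gr'.
by rewrite (gap_inj_l Gr' Gr).
Qed.

Lemma ex_endpt x y : Exit D x y -> Endpt D x.
Proof. by case=> [[a [Dax _ _]]|[b [Dxb _ _]]]; [exists a; left|exists b; right]. Qed.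

Lemma ex_excl a b y y' : D a b -> Gap D b y -> Gap D y' a ->
  (forall r, Gap D r a -> y - b < a - r) ->
  (forall l, Gap D b l -> a - y' < l - b) -> False.
Proof. by move=> Dab G G' /(_ _ G') h /(_ _ G); lra. Qed.

Lemma ex_fun x y y' : Exit D x y -> Exit D x y' -> y = y'.
Proof.
case=> [[a [D1 G1 h1]]|[b [D1 G1 h1]]] [[a' [D2 G2 h2]]|[b' [D2 G2 h2]]].
- exact: gap_inj_r G1 G2.
- have [ax xb] := sys_chain D1 D2; subst a b'.
  by case: (ex_excl D1 G1 G2 h1 h2).
- have [ax xb] := sys_chain D2 D1; subst a' b.
  by case: (ex_excl D1 G2 G1 h2 h1).
- exact: gap_inj_l G1 G2.
Qed.

Lemma step_ex x y : Step D x y -> Exit D x y /\ Exit D y x.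
Proof.
move=> [G h1 h2]; have [[a Da] [b Db] _ _] := G; split.
  by left; exists a; split=> // r; exact: h1.
by right; exists b; split=> // l; exact: h2.
Qed.

Lemma ex_step x y a b : D a x -> D y b -> Gap D x y ->
  (forall r, Gap D r a -> y - x < a - r) ->
  (forall l, Gap D b l -> y - x < l - b) -> Step D x y.
Proof.
move=> Da Db G h1 h2; split=> //.
  by move=> a' r Da'; rewrite (sys_inj_l Da' Da); exact: h1.
by move=> b' l Db'; rewrite (sys_inj_r Db' Db); exact: h2.
Qed.

Lemma step_in x y : Step D x y -> [/\ S x, S y & x < y].
Proof. by move=> [G _ _]; have [? ?] := gap_in G; split=> //; case: G. Qed.

Lemma step_endpt c : Endpt (Step D) c -> Endpt D c.
Proof.
by case=> a [] [[[u ?] [v ?] _ _] _ _]; [exists v; right|exists u; left].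
Qed.

Lemma step_dj x y x' y' : Step D x y -> Step D x' y' ->
  (x = x' /\ y = y') \/ y < x' \/ y' < x.
Proof.
wlog lexx' : x y x' y' / x <= x' => [th s1 s2|].
  have [le|/ltW le] := leP x x'; first exact: th.
  by have := th _ _ _ _ le s2 s1; intuition.
move=> s1 s2; have [G h1 h2] := s1; have [G' h1' h2'] := s2.
move: lexx'; rewrite le_eqVlt => /orP[/eqP xx'|xx'].
  by left; split=> //; subst x'; exact: gap_inj_r G G'.
right; left; have [_ [b Db] _ _] := G; have [[a' Da'] _ _ _] := G'.
have ya' := gap_ge G Da' xx'; have [_ _ a'x'] := sys_in sys Da'.
move: ya'; rewrite le_eqVlt => /orP[/eqP ya'|]; last by lra.
subst a'; have := h1' _ _ Da' G.
by have := h2 _ _ Da' G'; lra.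
Qed.

Definition nxt (u : R) : R := xget 0 [set l | Gap D u l].

Lemma nxtP a u : D a u -> Gap D u (nxt u).
Proof. by move=> /gap_next; rewrite /nxt; case: xgetP => // h [l /h]. Qed.

Lemma nxtE u l : Gap D u l -> nxt u = l.
Proof.
move=> G; have [[a Da] _ _ _] := G; exact: gap_inj_r (nxtP Da) G.
Qed.

Lemma gap_argmin u0 u2 a0 a2 : D a0 u0 -> D a2 u2 -> u0 <= u2 ->
  exists u, [/\ u0 <= u <= u2, exists a, D a u &
    forall a v, D a v -> u0 <= v <= u2 -> nxt u - u <= nxt v - v].
Proof.
move=> D0 D2 u02.
have [||u [[a Da] uu] umin] := @finite_argmin
   [set u | (exists a, D a u) /\ u0 <= u <= u2] (fun u => nxt u - u).
- apply: sub_finite_set (lf u0 u2) => u /= [[a /(sys_in sys)[]]].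
  by split.
- by exists u0; split; [exists a0|rewrite lexx].
by exists u; split=> //; [exists a|move=> b v Dv uv; apply: umin; split=> //; exists b].
Qed.

Lemma argmin_step u0 u2 u : (exists a, D a u0) -> (exists a, D a u2) ->
  (exists a, D a u) ->
  u0 < u < u2 ->
  (forall a v, D a v -> u0 <= v <= u2 -> nxt u - u <= nxt v - v) ->
  Step D u (nxt u) /\ nxt u <= u2.
Proof.
move=> [a0 D0] [a2 D2] [a Da] /andP[u0u uu2] umin.
have G := nxtP Da; have [_ [b Db] _ _] := G.
have nu2 : nxt u <= u2.
  by have := gap_ge G D2 uu2; have [_ _] := sys_in sys D2; lra.
split=> //.
apply: (@ex_step _ _ a b) => // [r Gr|l Gl].
  have [[a1 D1] _ _ _] := Gr.
  have u0r : u0 <= r.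
    have ua : u0 < a.
      have [[_ ?]|[//|h]] := sys_dj sys D0 Da; first lra.
      by have [_ _] := sys_in sys D0; lra.
    exact: gap_le Gr D0 ua.
  have ru : r < u by have [_ _ ? _] := Gr; have [_ _] := sys_in sys Da; lra.
  have := umin _ _ D1; rewrite (nxtE Gr) u0r => /(_ _).
  have -> : r <= u2 by lra.
  move=> /(_ isT) h; have := gap_neq Gr Da G.
  by rewrite neq_lt => /orP[|//]; lra.
have bu2 : b <= u2.
  have [[_ ->]|[h|h]] := sys_dj sys Db D2; [lra| |].
    by have [_ _] := sys_in sys D2; lra.
  by lra.
have ub : u0 <= b by have [_ _ ? _] := G; have [_ _] := sys_in sys Db; lra.
have := umin _ _ Db; rewrite ub bu2 => /(_ isT); rewrite (nxtE Gl) => h.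
have := gap_neq G Db Gl.
by rewrite neq_lt => /orP[//|]; lra.
Qed.

Definition unbounded_up A := forall M : R, exists2 x, A x & M < x.
Definition unbounded_dn A := forall M : R, exists2 x, A x & x < M.
Definition scattered A := A = set0 \/ (unbounded_up A /\ unbounded_dn A).

Lemma step_sys :
  (forall q : rat, scattered [set x | exists y, Gap D x y /\ y - x <= ratr q]) ->
  (forall q : rat, scattered [set x | exists y, Gap D x y /\ ratr q < y - x]) ->
  PairSystem S (Step D).
Proof.
move=> UA UB.
have [a [b [Dab _]]] := sys_up sys 0.
have [r Gr] := gap_prev Dab; have [l Gl] := gap_next Dab.
have [q [[xs [ys [Gs hs]]] [xb [yb [Gb hb]]]]] : exists q : rat,
    (exists x y, Gap D x y /\ y - x <= ratr q) /\
    (exists x y, Gap D x y /\ ratr q < y - x).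
  have := gap_neq Gr Dab Gl; rewrite neq_lt => /orP[h|h].
    have [q] := rat_in_itvoo h; rewrite in_itv /= => /andP[h1 h2]; exists q.
    by split; [exists r, a; split=> //; exact: ltW|exists b, l].
  have [q] := rat_in_itvoo h; rewrite in_itv /= => /andP[h1 h2]; exists q.
  by split; [exists b, l; split=> //; exact: ltW|exists r, a].
have {UA} [A0|[Aup Adn]] := UA q.
  have : [set x | exists y, Gap D x y /\ y - x <= ratr q] xs by exists ys.
  by rewrite A0.
have {UB} [B0|[Bup Bdn]] := UB q.
  have : [set x | exists y, Gap D x y /\ ratr q < y - x] xb by exists yb.
  by rewrite B0.
have key u0 u1 u2 y0 y1 y2 : u0 < u1 -> u1 < u2 -> Gap D u0 y0 -> Gap D u1 y1 ->
    Gap D u2 y2 -> ratr q < y0 - u0 -> y1 - u1 <= ratr q -> ratr q < y2 - u2 ->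
    exists x y, [/\ Step D x y, u0 < x & y <= u2].
  move=> u01 u12 G0 G1 G2 h0 h1 h2.
  have [[a0 D0] _ _ _] := G0; have [[a1 D1] _ _ _] := G1.
  have [[a2 D2] _ _ _] := G2.
  have [|u [/andP[u0u uu2] [a' Da'] umin]] := gap_argmin D0 D2; first lra.
  have um1 : nxt u - u <= y1 - u1.
    by rewrite -(nxtE G1); apply: umin _ _ D1 _; apply/andP; split; lra.
  have uu0 : u0 != u.
    by apply/eqP => e; move: um1; rewrite -e (nxtE G0); lra.
  have uu2' : u != u2.
    by apply/eqP => e; move: um1; rewrite e (nxtE G2); lra.
  have [|||||? ?] := @argmin_step u0 u2 u.
  - by exists a0.
  - by exists a2.
  - by exists a'.
  - by rewrite !lt_neqAle uu0 u0u uu2' uu2.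
  - by [].
  by exists u, (nxt u); split=> //; rewrite lt_neqAle uu0.
split.
- by move=> x y /step_in[? ? ?]; split=> //; exact: ltW.
- exact: step_dj.
- move=> M; have [u0 [y0 [G0 h0]] Mu0] := Bup M.
  have [u1 [y1 [G1 h1]] u01] := Aup u0; have [u2 [y2 [G2 h2]] u12] := Bup u1.
  have [x [y [sxy ? ?]]] := key _ _ _ _ _ _ u01 u12 G0 G1 G2 h0 h1 h2.
  by exists x, y; split=> //; lra.
- move=> M; have [u2 [y2 [G2 h2]] Mu2] := Bdn M.
  have [u1 [y1 [G1 h1]] u12] := Adn u2; have [u0 [y0 [G0 h0]] u01] := Bdn u1.
  have [x [y [sxy ? ?]]] := key _ _ _ _ _ _ u01 u12 G0 G1 G2 h0 h1 h2.
  by exists x, y; split=> //; lra.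
Qed.

End Fixed.
End PairSystems.

(** * Dynamics of exit points *)

Section Coalescence.
Context {T : Type}.
Implicit Types (g : T -> T) (x y z : T).

Definition coalesce g x y := exists m n, iter m g x = iter n g y.

Lemma coal_refl g x : coalesce g x x. Proof. by exists 0%N, 0%N. Qed.

Lemma coal_sym g x y : coalesce g x y -> coalesce g y x.
Proof. by move=> [m [n e]]; exists n, m. Qed.

Lemma coal_trans g y x z : coalesce g x y -> coalesce g y z -> coalesce g x z.
Proof.
move=> [m [n e]] [p [q e']]; exists (p + m)%N, (n + q)%N.
by rewrite iterD e -iterD addnC iterD e' iterD.
Qed.

Lemma coal_iter g n x : coalesce g x (iter n g x).
Proof. by exists n, 0%N. Qed.

End Coalescence.

Section Dynamics.
Context {R : realType}.
Implicit Types (S : set R) (D : R -> R -> Prop) (g h : R -> R).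

Record PairDynamics S D g : Prop := MkDyn {
  dyn_sys : PairSystem S D;
  dyn_S : forall x, S x -> S (g x);
  dyn_D : forall a b, D a b -> g a = b /\ g b = a;
  dyn_up : forall c x, Endpt D c -> S x -> c < x -> c <= g x;
  dyn_dn : forall c x, Endpt D c -> S x -> x < c -> g x <= c;
  dyn_reach : forall x, S x -> exists n, Endpt D (iter n g x) }.

Definition is_step S D g h := forall x, S x ->
  (forall y, Exit D x y -> h x = y) /\ ((forall y, ~ Exit D x y) -> h x = g x).

Section OneStep.
Variables (S : set R) (D : R -> R -> Prop) (g h : R -> R).
Hypotheses (lf : locally_finite S) (nt : no_ties S).
Hypotheses (dyn : PairDynamics S D g) (st : is_step S D g h).
Let sys := dyn_sys dyn.

Lemma right_exit_only a b l y : D a b -> a != b -> Gap D b l ->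
  (forall r, Gap D r a -> l - b < a - r) -> ~ Exit D a y.
Proof.
move=> Dab ab G ex [[a' [D1 _ _]]|[b' [D1 G1 h1]]].
  by have [_ e] := sys_chain sys D1 Dab; move: ab; rewrite e eqxx.
have e := sys_inj_r sys D1 Dab; subst b'.
exact: (ex_excl Dab G G1 ex h1).
Qed.

Lemma left_exit_only a b r y : D a b -> a != b -> Gap D r a ->
  (forall l, Gap D b l -> a - r < l - b) -> ~ Exit D b y.
Proof.
move=> Dab ab G ex [[a' [D1 G1 h1]]|[b' [D1 _ _]]].
  have e := sys_inj_l sys D1 Dab; subst a'.
  exact: (ex_excl Dab G1 G h1 ex).
by have [e _] := sys_chain sys Dab D1; move: ab; rewrite e eqxx.
Qed.

Lemma right_exit_path a b l : D a b -> Gap D b l ->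
  (forall r, Gap D r a -> l - b < a - r) -> exists n, iter n h a = b.
Proof.
move=> Dab G ex; have [->|ab] := eqVneq a b; first by exists 0%N.
exists 1%N; have [Sa _ _] := sys_in sys Dab.
rewrite /= (st Sa).2; first exact: (dyn_D dyn Dab).1.
by move=> y; exact: right_exit_only Dab ab G ex.
Qed.

Lemma left_exit_path a b r : D a b -> Gap D r a ->
  (forall l, Gap D b l -> a - r < l - b) -> exists n, iter n h b = a.
Proof.
move=> Dab G ex; have [->|ab] := eqVneq a b; first by exists 0%N.
exists 1%N; have [_ Sb _] := sys_in sys Dab.
rewrite /= (st Sb).2; first exact: (dyn_D dyn Dab).2.
by move=> y; exact: left_exit_only Dab ab G ex.
Qed.

Lemma right_or_left a b : D a b ->
  (exists l, Gap D b l /\ forall r, Gap D r a -> l - b < a - r) \/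
  (exists r, Gap D r a /\ forall l, Gap D b l -> a - r < l - b).
Proof.
move=> Dab; have [l Gl] := gap_next lf sys Dab.
have [r Gr] := gap_prev lf sys Dab.
have := gap_neq nt sys Gr Dab Gl; rewrite neq_lt => /orP[ar|lb].
  by right; exists r; split=> // l' Gl'; rewrite (gap_inj_r Gl' Gl).
by left; exists l; split=> // r' Gr'; rewrite (gap_inj_l sys Gr' Gr).
Qed.

Lemma pair_coal a b : D a b -> coalesce h a b.
Proof.
move=> Dab; case: (right_or_left Dab) => [[l [G e]]|[r [G e]]].
  by have [n <-] := right_exit_path Dab G e; exact: coal_iter.
by have [n <-] := left_exit_path Dab G e; apply: coal_sym; exact: coal_iter.
Qed.

Lemma pair_orbit a b c n : D a b -> (c = a \/ c = b) ->
  iter n g c = a \/ iter n g c = b.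
Proof.
move=> Dab cab; have [ga gb] := dyn_D dyn Dab.
by elim: n => //= n [->|->]; rewrite ?ga ?gb; [right|left].
Qed.

Lemma endpt_coal c c' : Endpt D c -> Endpt D c' -> coalesce g c c' ->
  exists a b, [/\ D a b, c = a \/ c = b & c' = a \/ c' = b].
Proof.
move=> /endpt_pair[a [b [Dab ca]]] /endpt_pair[a' [b' [Dab' ca']]] [m [n e]].
have := pair_orbit m Dab ca; have := pair_orbit n Dab' ca'.
rewrite e => h1 h2; have [ea eb] := sys_common sys Dab Dab' h2 h1; subst a' b'.
by exists a, b.
Qed.

Lemma nonendpt_step x : S x -> ~ Endpt D x -> h x = g x.
Proof. by move=> Sx xE; apply: (st Sx).2 => y /ex_endpt. Qed.

Lemma dyn_iter n x : S x -> S (iter n g x).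
Proof. by move=> Sx; elim: n => //= n; exact: (dyn_S dyn). Qed.

Lemma reach_both x : S x ->
  exists n, Endpt D (iter n g x) /\ iter n h x = iter n g x.
Proof.
move=> Sx; have ex : exists n, `[< Endpt D (iter n g x) >].
  by have [n xn] := dyn_reach dyn Sx; exists n; apply/asboolP.
case: (ex_minnP ex) => n /asboolP En' nmin.
exists n; split=> //.
suff : forall m, (m <= n)%N -> iter m h x = iter m g x by exact.
elim=> //= m IH mn; rewrite IH ?(ltnW mn)//.
apply: nonendpt_step; first exact: dyn_iter.
by move=> /asboolP /nmin; rewrite leqNgt mn.
Qed.

Lemma coal_step x y : S x -> S y -> coalesce g x y -> coalesce h x y.
Proof.
move=> Sx Sy xy; have [m [Em em]] := reach_both Sx.
have [n [En en]] := reach_both Sy.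
have [|a [b [Dab ca cb]]] := endpt_coal Em En.
  apply: (@coal_trans _ _ x); first exact/coal_sym/coal_iter.
  by apply: coal_trans xy _; exact: coal_iter.
apply: coal_trans (coal_iter h m x) _; rewrite em.
apply: (coal_trans (y := iter n h y)); last exact/coal_sym/coal_iter.
rewrite en; have pc := pair_coal Dab.
by case: ca => ->; case: cb => ->; [exact: coal_refl|exact: pc|
  exact: coal_sym pc|exact: coal_refl].
Qed.

Hypothesis sys' : PairSystem S (Step D).

Lemma right_exit_reach a b l : D a b -> Gap D b l ->
  (forall r, Gap D r a -> l - b < a - r) ->
  exists n x y, [/\ iter n h b = x, Step D x y, b <= x &
    forall u v, Step D u v -> b <= u -> x <= u].
Proof.
move=> D0 G0 ex0; have [x0 [y0 [S0 bx0]]] := sys_up sys' b.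
pose goal b := exists n x y, [/\ iter n h b = x, Step D x y, b <= x &
    forall u v, Step D u v -> b <= u -> x <= u].
pose bad := [set b | [/\ b <= x0, ~ goal b & exists a l, [/\ D a b, Gap D b l &
  forall r, Gap D r a -> l - b < a - r]]].
apply: contrapT => ngoal.
have [||b1 [[b1x0 ng1 [a1 [l1 [D1 G1 e1]]]] _ b1max]] :=
  @locally_finite_max _ S bad (x0 + 1) lf.
- by move=> c [_ _ [a' [l' [/(sys_in sys)[]]]]].
- by exists b; [split=> //; [exact: ltW|exists a, l]|lra].
have [_ [r Dr] b1l1 _] := G1; have [_ _ l1r] := sys_in sys Dr.
have Sb1 : S b1 by case: (sys_in sys D1).
have nS v : ~ Step D b1 v.
  by move=> sv; apply: ng1; exists 0%N, b1, v; split.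
have hb1 : h b1 = l1 by apply: (st Sb1).1; left; exists a1.
have b1x0' : b1 < x0.
  by rewrite lt_neqAle b1x0 andbT; apply/eqP => e; subst x0; exact: (nS y0).
have [[l2 [G2 e2]]|[r2 [G2 e2]]] := right_or_left Dr; last first.
  apply: (nS l1); apply: (ex_step sys D1 Dr G1) => //.
  by rewrite -(gap_inj_l sys G2 G1).
have rmin u v : Step D u v -> b1 <= u -> r <= u.
  move=> suv; rewrite le_eqVlt => /orP[/eqP e|b1u].
    by case: (nS v); rewrite e.
  have [[[a' Da'] _ _ _] _ _] := suv.
  have la' := gap_ge sys G1 Da' b1u; have [_ _ a'u] := sys_in sys Da'.
  by have [[_ ->]//|[h1|h1]] := sys_dj sys Dr Da'; lra.
have rx0 : r <= x0 by apply: rmin S0 _.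
have ngr : ~ goal r.
  move=> [n [x [y [nx sxy rx xmin]]]]; apply: ng1.
  have [m em] := right_exit_path Dr G2 e2.
  exists (n + m).+1, x, y; split=> //; last first.
  - by move=> u v suv b1u; apply: xmin (suv) (rmin _ _ suv b1u).
  - lra.
  - by rewrite iterSr hb1 iterD em.
have : r <= b1; last lra.
apply: b1max; last lra.
by split=> //; exists l1, l2.
Qed.

Lemma left_exit_reach a b r : D a b -> Gap D r a ->
  (forall l, Gap D b l -> a - r < l - b) ->
  exists n x y, [/\ iter n h a = y, Step D x y, y <= a &
    forall u v, Step D u v -> v <= a -> v <= y].
Proof.
move=> D0 G0 ex0; have [x0 [y0 [S0 y0a]]] := sys_dn sys' a.
pose goal a := exists n x y, [/\ iter n h a = y, Step D x y, y <= a &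
    forall u v, Step D u v -> v <= a -> v <= y].
pose bad := [set a | [/\ y0 <= a, ~ goal a & exists b r, [/\ D a b, Gap D r a &
  forall l, Gap D b l -> a - r < l - b]]].
apply: contrapT => ngoal.
have [||a1 [[y0a1 ng1 [b1 [r1 [D1 G1 e1]]]] _ a1min]] :=
  @locally_finite_min _ S bad (y0 - 1) lf.
- by move=> c [_ _ [a' [l' [/(sys_in sys)[]]]]].
- by exists a; [split=> //; [exact: ltW|exists b, r]|lra].
have [[l Dl] _ r1a1 _] := G1; have [_ _ lr1] := sys_in sys Dl.
have Sa1 : S a1 by case: (sys_in sys D1).
have nS u : ~ Step D u a1.
  by move=> su; apply: ng1; exists 0%N, u, a1; split.
have ha1 : h a1 = r1 by apply: (st Sa1).1; right; exists b1.
have y0a1' : y0 < a1.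
  by rewrite lt_neqAle y0a1 andbT; apply/eqP => e; subst y0; exact: (nS x0).
have [[l2 [G2 e2]]|[r2 [G2 e2]]] := right_or_left Dl.
  apply: (nS r1); apply: (ex_step sys Dl D1 G1) => //.
  by rewrite -(gap_inj_r G2 G1).
have lmax u v : Step D u v -> v <= a1 -> v <= l.
  move=> suv; rewrite le_eqVlt => /orP[/eqP e|va1].
    by case: (nS u); rewrite -e.
  have [[_ [b' Db'] _ _] _ _] := suv.
  have [_ _ vb'] := sys_in sys Db'.
  have [[-> _]//|[h1|h1]] := sys_dj sys Dl Db'; try lra.
  by have [_ _ _ /(_ _ _ Db')] := G1; lra.
have ly0 : y0 <= l by apply: lmax S0 _.
have ngl : ~ goal l.
  move=> [n [x [y [ny sxy yl ymax]]]]; apply: ng1.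
  have [m em] := left_exit_path Dl G2 e2.
  exists (n + m).+1, x, y; split=> //; last first.
  - by move=> u v suv va1; apply: ymax (suv) (lmax _ _ suv va1).
  - lra.
  - by rewrite iterSr ha1 iterD em.
have : a1 <= l; last lra.
apply: a1min; last lra.
by split=> //; exists r1, r2.
Qed.

Lemma ex_in x y : Exit D x y -> S x /\ S y.
Proof.
by case=> [[a [_ /(gap_in sys)[] //]]|[b [_ /(gap_in sys)[] //]]].
Qed.

Lemma dyn_step : PairDynamics S (Step D) h.
Proof.
have hE x : S x -> (exists2 y, Exit D x y & h x = y) \/ h x = g x.
  move=> Sx; have [[y xy]|nex] := pselect (exists y, Exit D x y).
    by left; exists y => //; exact: (st Sx).1.
  by right; apply: (st Sx).2 => y xy; apply: nex; exists y.
split=> //.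
- move=> x Sx; have [[y xy ->]|->] := hE _ Sx; last exact: (dyn_S dyn Sx).
  by case: (ex_in xy).
- move=> a b sab; have [e1 e2] := step_ex sab; have [Sa Sb _] := step_in sys sab.
  by split; [exact: (st Sa).1 _ e1|exact: (st Sb).1 _ e2].
- move=> c x /step_endpt Ec Sx cx; have [[y xy ->]|->] := hE _ Sx; last first.
    exact: (dyn_up dyn Ec Sx cx).
  case: xy => [[a [_ [_ _ ? _] _]]|[b [Dxb G _]]]; first lra.
  by have [//|] := gap_endpt sys G Ec; lra.
- move=> c x /step_endpt Ec Sx cx; have [[y xy ->]|->] := hE _ Sx; last first.
    exact: (dyn_dn dyn Ec Sx cx).
  case: xy => [[a [Dax G _]]|[b [_ [_ _ ? _] _]]]; last lra.
  by have [|//] := gap_endpt sys G Ec; lra.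
- move=> x Sx; have [m [Em em]] := reach_both Sx.
  have reach a b c : D a b -> c = a \/ c = b ->
      exists n, Endpt (Step D) (iter n h c).
    move=> Dab ca; have [[l [G e]]|[r [G e]]] := right_or_left Dab.
      have [n [x1 [y1 [ex s1 _ _]]]] := right_exit_reach Dab G e.
      have [k ek] := right_exit_path Dab G e.
      have E1 : Endpt (Step D) x1 by exists y1; right.
      by case: ca => ->; [exists (n + k)%N; rewrite iterD ek ex|exists n; rewrite ex].
    have [n [x1 [y1 [ex s1 _ _]]]] := left_exit_reach Dab G e.
    have [k ek] := left_exit_path Dab G e.
    have E1 : Endpt (Step D) y1 by exists x1; left.
    by case: ca => ->; [exists n; rewrite ex|exists (n + k)%N; rewrite iterD ek ex].
  have [n En] : exists n, Endpt (Step D) (iter n h (iter m g x)).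
    by case: Em => a [Da|Da]; [apply: reach Da _; right|apply: reach Da _; left].
  by exists (n + m)%N; rewrite iterD em.
Qed.

Lemma not_lmax_coal r l : Gap D r l -> ~ LocalMaxGap D r l -> coalesce h r l.
Proof.
move=> G nmax; have [[a Da] [b Db] _ _] := G; have [Sr Sl] := gap_in sys G.
have [p Gp] := gap_prev lf sys Da; have [q Gq] := gap_next lf sys Db.
have := gap_neq nt sys Gp Da G; rewrite neq_lt => /orP[hp|hp]; last first.
  have <- : h r = l; last exact: (coal_iter h 1).
  apply: (st Sr).1; left; exists a; split=> // p' Gp'.
  by rewrite (gap_inj_l sys Gp' Gp).
have := gap_neq nt sys G Db Gq; rewrite neq_lt => /orP[hq|hq].
  have <- : h l = r; last exact/coal_sym/(coal_iter h 1).
  apply: (st Sl).1; right; exists b; split=> // q' Gq'.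
  by rewrite (gap_inj_r Gq' Gq).
case: nmax; split=> //.
  by move=> a' p' Da'; rewrite (sys_inj_l sys Da' Da) => /(gap_inj_l sys Gp) <-.
by move=> b' q' Db'; rewrite (sys_inj_r sys Db' Db) => /(gap_inj_r Gq) <-.
Qed.

Lemma lmax_gap r l : LocalMaxGap D r l -> exists r' l',
  [/\ Gap (Step D) r' l', r' <= r, l <= l', coalesce h r r' & coalesce h l l'].
Proof.
move=> [G hl hr]; have [[a Da] [b Db] rl _] := G.
have [_ _ ar] := sys_in sys Da; have [_ _ lb] := sys_in sys Db.
have nS v : ~ Step D r v.
  move=> sv; have [G' h1 _] := sv; have [r0 Gr0] := gap_prev lf sys Da.
  have := hl _ _ Da Gr0; have := h1 _ _ Da Gr0.
  by rewrite (gap_inj_r G' G); lra.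
have [[l2 [G2 e2]]|[r2 [G2 e2]]] := right_or_left Db; last first.
  have [l3 G3] := gap_next lf sys Db.
  by have := e2 _ G3; have := hr _ _ Db G3; rewrite (gap_inj_l sys G2 G); lra.
have [[l3 [G3 e3]]|[r3 [G3 e3]]] := right_or_left Da.
  have [r4 G4] := gap_prev lf sys Da.
  by have := e3 _ G4; have := hl _ _ Da G4; rewrite (gap_inj_r G3 G); lra.
have [n [x1 [y1 [ex1 s1 bx1 min1]]]] := right_exit_reach Db G2 e2.
have [k [x2 [y2 [ex2 s2 y2a max2]]]] := left_exit_reach Da G3 e3.
exists y2, x1; split; last 4 first.
- lra.
- lra.
- apply: coal_trans (coal_sym (pair_coal Da)) _.
  by rewrite -ex2; exact: coal_iter.
- by apply: coal_trans (pair_coal Db) _; rewrite -ex1; exact: coal_iter.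
split; [by exists x2|by exists y1|lra|].
move=> u v suv y2u; have [bu|ub] := leP b u; first exact: min1 suv bu.
have [[[c Dc] _ uv _] _ _] := suv; have [_ _ cu] := sys_in sys Dc.
have ur : u < r.
  have ul : u <= r.
    apply: (gap_le sys G Dc); have [[_ ?]|[h1|h1]] := sys_dj sys Dc Db; lra.
  rewrite lt_neqAle ul andbT; apply/eqP => e; subst u; exact: (nS v).
have ua : u < a by have [[_ ?]|[h1|h1]] := sys_dj sys Dc Da; lra.
have va : v <= a.
  by have [[_ [w Dv] _ gap] _ _] := suv; apply: gap Da ua.
by have := max2 _ _ suv va; lra.
Qed.

End OneStep.

End Dynamics.

(** * Levels of the construction *)

Section JoinedPaths.
Context {R : realType}.
Implicit Types (adj : R -> R -> Prop).

Lemma joined_refl adj x : joined adj x x.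
Proof. by exists 0%N, (fun=> x). Qed.

Lemma joined1 adj x y : adj x y -> joined adj x y.
Proof.
move=> xy; exists 1%N, (fun i => if i is 0%N then x else y).
by split=> // -[|//].
Qed.

Lemma joined_sym adj x y : (forall u v, adj u v -> adj v u) ->
  joined adj x y -> joined adj y x.
Proof.
move=> sym [n [z [z0 zn adjz]]]; exists n, (fun i => z (n - i)%N).
split; rewrite ?subn0 ?subnn// => i ni; apply: sym.
by have := adjz (n - i.+1)%N; rewrite -subSn// subSS; apply; exact: leq_subr.
Qed.

Lemma joined_trans adj x y w : joined adj x y -> joined adj y w -> joined adj x w.
Proof.
move=> [n [z [z0 zn adjz]]] [m [z' [z'0 z'm adjz']]].
exists (n + m)%N, (fun i => if (i <= n)%N then z i else z' (i - n)%N); split.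
- by [].
- case: leqP => [|_]; last by rewrite addKn.
  by rewrite -[X in (_ <= X)%N]addn0 leq_add2l leqn0 => /eqP e; subst m; rewrite addn0 zn -z'0.
move=> i inm; have [ltin|leni] := ltnP i n.
  by rewrite (ltnW ltin); exact: adjz.
have h : adj (z' (i - n)%N) (z' (i - n).+1).
  by apply: adjz'; rewrite ltn_subLR.
rewrite -subSn// in h; move: h; have [lein|//] := leqP i n.
have -> : i = n by apply/eqP; rewrite eqn_leq lein.
by rewrite subnn z'0 zn.
Qed.

End JoinedPaths.

Section Levels.
Context {R : realType}.
Implicit Types (S : set R) (f : nat -> R -> R).

(* [Level S k.+1] is the set of 2-cycles of f^k; level 0 consists of degenerate
   pairs, so that the nearest neighbour graph is itself an exit step. *)
Fixpoint Level S k : R -> R -> Prop :=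
  if k is j.+1 then Step (Level S j) else fun a b => S a /\ a = b.

Lemma lev_in S k a b : Level S k a b -> S a /\ S b.
Proof.
elim: k a b => [a b [sa <-]//|k IH a b].
by move=> [[[c /IH[_ ?]] [d /IH[? _]] _ _] _ _].
Qed.

Definition surviving S : set R := [set z | S z /\
  forall k, exists r l, [/\ LocalMaxGap (Level S k) r l, r <= z & z < l]].

Definition undying S : set R := [set x | forall k, Endpt (Level S k) x].

Definition small_gaps S k (t : R) : set R :=
  [set x | exists y, Gap (Level S k) x y /\ y - x <= t].
Definition large_gaps S k (t : R) : set R :=
  [set x | exists y, Gap (Level S k) x y /\ t < y - x].

Record generic S : Prop := Generic {
  gen_lf : locally_finite S;
  gen_nt : no_ties S;
  gen_ne : S !=set0;
  gen_S : scattered S;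
  gen_small : forall k (q : rat), scattered (small_gaps S k (ratr q));
  gen_large : forall k (q : rat), scattered (large_gaps S k (ratr q));
  gen_surviving : scattered (surviving S);
  gen_undying : scattered (undying S) }.

Lemma scattered_subsingleton (A : set R) : scattered A ->
  (forall x y, A x -> A y -> x < y -> False) -> A = set0.
Proof.
move=> [//|[up _]] h; have [x Ax _] := up 0; have [y Ay xy] := up x.
by case: (h _ _ Ax Ay xy).
Qed.

Section Generic.
Variables (S : set R) (gen : generic S).
Let lf := gen_lf gen.
Let nt := gen_nt gen.

Lemma lev_sys k : PairSystem S (Level S k).
Proof.
elim: k => [|k IH] /=; last first.
  by apply: step_sys => // q; [exact: gen_small|exact: gen_large].
have [S0|[up dn]] := gen_S gen; first by have [x] := gen_ne gen; rewrite S0.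
split=> [a b [Sa <-]//|a b a' b' [_ <-] [_ <-]|M|M].
- by have [|//|->] := ltgtP a a'; [right; left|right; right|left].
- by have [x Sx Mx] := up M; exists x, x.
- by have [x Sx Mx] := dn M; exists x, x.
Qed.

Lemma lev_lt k a b : Level S k.+1 a b -> a < b.
Proof. by case/(step_in (lev_sys k)). Qed.

Lemma lev_chain k a x b : Level S k.+1 a x -> Level S k.+1 x b -> False.
Proof.
move=> D1 D2; have [ax _] := sys_chain (lev_sys k.+1) D1 D2.
by have := lev_lt D1; rewrite ax ltxx.
Qed.

Lemma surviving_endpt z w : surviving S z -> surviving S w -> z < w ->
  forall k, exists2 c, Endpt (Level S k) c & z < c <= w.
Proof.
move=> [Sz hz] [Sw hw] zw; elim=> [|k [c Ec /andP[zc cw]]].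
  by exists w; [exists w; left|rewrite zw lexx].
have sys := lev_sys k; set D := Level S k in Ec sys.
have [r [l [mrl rz zl]]] := hz k; have [r2 [l2 [mrl2 r2w wl2]]] := hw k.
have [G h1 h2] := mrl; have [G2 h3 h4] := mrl2.
have lc : l <= c by have [|//] := gap_endpt sys G Ec; lra.
have cr2 : c <= r2 by have [//|] := gap_endpt sys G2 Ec; lra.
have [[a Da] [b Db] rl _] := G; have [[a2 Da2] [b2 Db2] r2l2 _] := G2.
have [_ _ ar] := sys_in sys Da; have [_ _ lb] := sys_in sys Db.
have [_ _ a2r2] := sys_in sys Da2.
have [|u [/andP[ru ur2] [au Dau] umin]] := gap_argmin lf sys Da Da2; first lra.
have br2 : b <= r2 by have [[_ ?]|[?|?]] := sys_dj sys Db Da2; lra.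
have ra2 : r < a2 by have := gap_ge sys G Da2; lra.
have ur : r != u.
  apply/eqP => e; have [q Gq] := gap_next lf sys Db.
  have := h2 _ _ Db Gq; have := umin _ _ Db.
  rewrite -e (nxtE lf sys G) (nxtE lf sys Gq) br2.
  have -> : r <= b by lra.
  by move=> /(_ isT); lra.
have ur2' : u != r2.
  apply/eqP => e; have [p Gp] := gap_prev lf sys Da2.
  have [[a3 Da3] _ pa2 _] := Gp.
  have rp : r <= p by exact: (gap_le sys Gp Da ra2).
  have := h3 _ _ Da2 Gp; have := umin _ _ Da3.
  rewrite e (nxtE lf sys G2) (nxtE lf sys Gp) rp.
  have -> : p <= r2 by lra.
  by move=> /(_ isT); lra.
have [|||||su nu] := @argmin_step _ _ _ lf nt sys r r2 u.
- by exists a.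
- by exists a2.
- by exists au.
- by rewrite !lt_neqAle ur ru ur2' ur2.
- by [].
exists u; first by exists (nxt D u); right.
have : l <= au by apply: (gap_ge sys G Dau); rewrite lt_neqAle ur.
by have [_ _] := sys_in sys Dau; move=> ? ?; apply/andP; split; lra.
Qed.

Lemma surviving0 : surviving S = set0.
Proof.
apply: (scattered_subsingleton (gen_surviving gen)) => z w sz sw zw.
have Eh := surviving_endpt sz sw zw; have [Sz hz] := sz.
pose A := [set c | exists k r, [/\ LocalMaxGap (Level S k.+1) r c, r <= z, z < c & c <= w]].
have inA k : exists2 c, A c & exists r, LocalMaxGap (Level S k.+1) r c /\ r <= z.
  have [r [l [mrl rz zl]]] := hz k.+1; exists l; last by exists r.
  exists k, r; split=> //; have [c Ec /andP[zc cw]] := Eh k.+1.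
  have [G _ _] := mrl.
  by have [|] := gap_endpt (lev_sys k.+1) G Ec; lra.
have [||c [[k [r [mrc rz zc cw]]] _ cmax]] := @locally_finite_max _ S A (w + 1) lf.
- by move=> c [k [r [[/(gap_in (lev_sys _))[]]]]].
- by have [c Ac _] := inA 0%N; exists c => //; have [k [r [_ _ _]]] := Ac; lra.
have [c' Ac' [r' [mrc' rz']]] := inA k.+1.
have [k' [r'' [_ _ zc' c'w]]] := Ac'.
have c'c : c' <= c by apply: cmax => //; lra.
have [G _ _] := mrc; have [G' _ _] := mrc'.
have [_ [b' Db'] _ _] := G'.
have cc' : c <= c'.
  have Ec' : Endpt (Level S k.+1) c' by apply: step_endpt; exists b'; right.
  by have [|//] := gap_endpt (lev_sys k.+1) G Ec'; lra.
have e : c' = c by apply/eqP; rewrite eq_le c'c.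
move: Db' => /= [[[a Da] _ _ _] _ _]; have [_ [b Db] _ _] := G.
by rewrite e in Da; exact: (lev_chain Da Db).
Qed.

Lemma undying_next k x w : undying S x -> Level S k.+1 x w ->
  exists2 v, Level S k.+3 x v & w < v.
Proof.
move=> ux xw; have [p Dpx] : exists p, Level S k.+2 p x.
  have [p [//|Dxp]] := ux k.+2; first by move=> ?; exists p.
  by have [[[a Da] _ _ _] _ _] := Dxp; case: (lev_chain Da xw).
have [v Dxv] : exists v, Level S k.+3 x v.
  have [v [Dvx|//]] := ux k.+3; last by move=> ?; exists v.
  by have [[_ [a Da] _ _] _ _] := Dvx; case: (lev_chain Dpx Da).
exists v => //.
have [[_ [b Db] xv _] _ _] := Dxv.
have Ev : Endpt (Level S k.+2) v by exists b; right.
have wv : w <= v.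
  have [a' [b' [Dab' va']]] := endpt_pair (step_endpt Ev).
  have [_ _ a'b'] := sys_in (lev_sys k.+1) Dab'.
  have [[? ?]|[?|?]] := sys_dj (lev_sys k.+1) xw Dab'.
  - by case: va' => e; lra.
  - by case: va' => e; lra.
  - by case: va' => e; lra.
rewrite lt_neqAle wv andbT; apply/eqP => e; rewrite -e in Db.
have [G1 h1 h2] := Dpx; have [G2 h3 h4] := Db.
by have := h2 _ _ xw G2; have := h3 _ _ xw G1; lra.
Qed.

Lemma undying0 : undying S = set0.
Proof.
apply: (scattered_subsingleton (gen_undying gen)) => x y ux uy xy.
pose A := [set w | exists k, Level S k.+1 x w].
have Ay w : A w -> w <= y.
  move=> [k xw]; have [a [b [Dab yab]]] := endpt_pair (uy k.+1).
  have [_ _ ab] := sys_in (lev_sys k.+1) Dab.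
  by have [[? ?]|[?|?]] := sys_dj (lev_sys k.+1) xw Dab; case: yab => e; lra.
have [||w [[k xw] _ wmax]] := @locally_finite_max _ S A (y + 1) lf.
- by move=> w [k /(sys_in (lev_sys k.+1))[]].
- suff [w Aw] : exists w, A w by exists w => //; have := Ay _ Aw; lra.
  have [a [ax|xa]] := ux 1%N; last by exists a, 0%N.
  have [b [bx|xb]] := ux 2%N; last by exists b, 1%N.
  by have [[_ [c Dc] _ _] _ _] := bx; case: (lev_chain ax Dc).
have [v xv wv] := undying_next ux xw.
have Av : A v by exists k.+2.
by have := wmax _ Av; have := Ay _ Av; lra.
Qed.

End Generic.

Section Exits.
Variables (S : set R) (D : R -> R -> Prop).
Hypotheses (lf : locally_finite S) (nt : no_ties S) (sys : PairSystem S D).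

Lemma endpt_out r a b l y : Gap D r a -> D a b -> Gap D b l -> Endpt D y ->
  y <> a -> y <> b -> y <= r \/ l <= y.
Proof.
move=> G Dab G' Ey ya yb; have [|ay] := gap_endpt sys G Ey; first by left.
have [yb'|] := gap_endpt sys G' Ey; last by right.
have [a' [b' [Dab' e]]] := endpt_pair Ey.
have [_ _ ?] := sys_in sys Dab'; have [_ _ ?] := sys_in sys Dab.
have [[? ?]|[?|?]] := sys_dj sys Dab Dab'; first by subst a' b'; case: e.
  by case: e => e; lra.
by case: e => e; lra.
Qed.

Lemma exitP a b x y : D a b -> (x = a \/ x = b) ->
  ([/\ Endpt D y, y <> a, y <> b & forall x' y', (x' = a \/ x' = b) ->
     Endpt D y' -> y' <> a -> y' <> b -> `|x - y| <= `|x' - y'|]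
   <-> Exit D x y).
Proof.
move=> Dab xab; have [r Gr] := gap_prev lf sys Dab.
have [l Gl] := gap_next lf sys Dab; have [_ _ ab] := sys_in sys Dab.
have [[p Dp] _ ra _] := Gr; have [_ [q Dq] bl _] := Gl.
have out := endpt_out Gr Dab Gl; have neq := gap_neq nt sys Gr Dab Gl; split.
  move=> [Ey ya yb ymin].
  have hl : `|x - y| <= `|b - l|.
    by apply: ymin; [right|exists q; right|move=> e; lra|move=> e; lra].
  have hr : `|x - y| <= `|a - r|.
    by apply: ymin; [left|exists p; left|move=> e; lra|move=> e; lra].
  have ebl : `|b - l| = l - b by rewrite distrC gtr0_norm //; lra.
  have ear : `|a - r| = a - r by rewrite gtr0_norm //; lra.
  move: hl hr; rewrite ebl ear => hl hr.
  case: (out _ Ey ya yb) => hy.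
    have hx := ler_norm (x - y).
    have [ex ey] : x = a /\ y = r by case: xab => ?; split; lra.
    subst x y; right; exists b; split=> // l' Gl'.
    rewrite (gap_inj_r Gl' Gl).
    by move: neq hl; rewrite ear le_eqVlt => /negbTE ->.
  have hx := ler_norm (y - x); rewrite distrC in hx.
  have [ex ey] : x = b /\ y = l by case: xab => ?; split; lra.
  subst x y; left; exists a; split=> // r' Gr'.
  rewrite (gap_inj_l sys Gr' Gr).
  by move: neq hr; rewrite ebl le_eqVlt eq_sym => /negbTE ->.
case=> [[a' [D1 G1 e1]]|[b' [D1 G1 e1]]].
  have [ea eb] := sys_common sys Dab D1 xab (or_intror erefl); subst a' x.
  have ey := gap_inj_r G1 Gl; subst y; have h := e1 _ Gr.
  split; [by exists q; right|by move=> e; lra|by move=> e; lra|].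
  move=> x' y' xab' Ey' ya' yb'.
  have -> : `|b - l| = l - b by rewrite distrC gtr0_norm //; lra.
  have h1 := ler_norm (x' - y'); have h2 := ler_norm (y' - x').
  rewrite distrC in h2.
  by case: (out _ Ey' ya' yb') => ?; case: xab' => ?; lra.
have [ea eb] := sys_common sys Dab D1 xab (or_introl erefl); subst b' x.
have ey := gap_inj_l sys G1 Gr; subst y; have h := e1 _ Gl.
split; [by exists p; left|by move=> e; lra|by move=> e; lra|].
move=> x' y' xab' Ey' ya' yb'.
have -> : `|a - r| = a - r by rewrite gtr0_norm //; lra.
have h1 := ler_norm (x' - y'); have h2 := ler_norm (y' - x').
rewrite distrC in h2.
by case: (out _ Ey' ya' yb') => ?; case: xab' => ?; lra.
Qed.

Variable g : R -> R.
Hypotheses (dyn : PairDynamics S D g) (nondeg : forall a b, D a b -> a < b).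

Lemma cycle_pointsE y : cycle_points S g y <-> Endpt D y.
Proof.
split=> [[Sy [ggy gy]]|Ey].
  have gE c : Endpt D c -> Endpt D (g c).
    move=> /endpt_pair[a [b [Dab]]]; have [ga gb] := dyn_D dyn Dab.
    by move=> [->|->]; rewrite ?ga ?gb; [exists a; left|exists b; right].
  have [n En] := dyn_reach dyn Sy.
  have : iter n g y = y \/ iter n g y = g y.
    by elim: n {En} => [|n [e|e]] /=; rewrite ?e; [left|right|left].
  by move=> [e|e]; rewrite e in En => //; rewrite -ggy; exact: gE.
split; first exact: (endpt_in sys Ey).
have [a [b [Dab]]] := endpt_pair Ey; have [ga gb] := dyn_D dyn Dab.
have := nondeg Dab => ab.
by move=> [->|->]; rewrite /on_2cycle ?ga ?gb ?ga; split=> // e; lra.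
Qed.

Lemma is_exitE x y : is_exit S g x y <-> Exit D x y.
Proof.
have key : Endpt D x -> (is_exit S g x y <-> Exit D x y).
  move=> Exit; have [a [b [Dab xab]]] := endpt_pair Exit.
  rewrite -(exitP _ Dab xab); have [ga gb] := dyn_D dyn Dab.
  have gx z : (z = a \/ z = b) <-> (z = x \/ z = g x).
    by case: xab => ->; rewrite ?ga ?gb; intuition.
  split=> [[_ /cycle_pointsE Ey yx ygx ymin]|[Ey ya yb ymin]].
    have [ya yb] : y <> a /\ y <> b.
      by move: yx ygx; case: xab => ->; rewrite ?ga ?gb; intuition.
    split=> // x' y' /gx x'x /cycle_pointsE Ey' ya' yb'; apply: ymin => //.
      by move: ya' yb'; case: xab => ->; rewrite ?ga ?gb.
    by move: ya' yb'; case: xab => ->; rewrite ?ga ?gb.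
  split; [exact/cycle_pointsE|exact/cycle_pointsE| | |].
  - by move: ya yb; case: xab => ->.
  - by move: ya yb; case: xab => ->; rewrite ?ga ?gb.
  move=> x' y' /gx x'x /cycle_pointsE Ey' ya' yb'; apply: ymin => //.
    by move: ya' yb'; case: xab => ->; rewrite ?ga ?gb.
  by move: ya' yb'; case: xab => ->; rewrite ?ga ?gb.
split=> h; have Ex0 : Endpt D x.
- by have [/cycle_pointsE] := h.
- exact/key.
- exact: ex_endpt h.
- exact/key.
Qed.

Lemma joined_coal x y : joined (ugraph_adj S g) x y -> coalesce g x y.
Proof.
move=> [n [z [<- <- adjz]]]; suff : forall i, (i <= n)%N -> coalesce g (z 0%N) (z i) by exact.
elim=> [_|i IH ni]; first exact: coal_refl.
apply: coal_trans (IH (ltnW ni)) _; have [_ [_ [e|e]]] := adjz _ ni.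
  by rewrite -e; exact: (coal_iter g 1).
by rewrite -e; apply: coal_sym; exact: (coal_iter g 1).
Qed.

Lemma orbit_le a r y n : D a r -> S y -> y <= r -> iter n g y <= r.
Proof.
move=> Dar Sy yr; elim: n => //= n IH.
move: IH; rewrite le_eqVlt => /orP[/eqP ->|lt].
  by rewrite (dyn_D dyn Dar).2; exact: ltW (nondeg Dar).
by apply: (dyn_dn dyn) lt; [exists a; left|exact: dyn_iter dyn _ _ Sy].
Qed.

Lemma orbit_ge l b y n : D l b -> S y -> l <= y -> l <= iter n g y.
Proof.
move=> Dlb Sy yr; elim: n => //= n IH.
move: IH; rewrite le_eqVlt => /orP[/eqP <-|lt].
  by rewrite (dyn_D dyn Dlb).1; exact: ltW (nondeg Dlb).
by apply: (dyn_up dyn) lt; [exists b; right|exact: dyn_iter dyn _ _ Sy].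
Qed.

Lemma dyn_wellformed : chn_wellformed S g.
Proof.
split=> [x Sx|x Sx]; first exact: (dyn_S dyn Sx).
have [n En] := dyn_reach dyn Sx; have [a [b [Dab cab]]] := endpt_pair En.
set c := iter n g x in En cab.
have cx : coalesce g c x by apply: coal_sym; exact: coal_iter.
have [r Gr] := gap_prev lf sys Dab; have [l Gl] := gap_next lf sys Dab.
have [[p Dp] _ ra _] := Gr; have [_ [q Dq] bl _] := Gl.
have ab := nondeg Dab; split.
  apply: sub_finite_set (lf r l) => y [Sy /joined_coal xy]; split=> //=.
  have [i [j e]] := coal_trans cx xy.
  have := pair_orbit dyn i Dab cab; rewrite e => h.
  apply/andP; split; rewrite leNgt; apply/negP => lt.
    have := orbit_le j Dp Sy (ltW lt); case: h => ->; lra.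
  have := orbit_ge j Dq Sy (ltW lt); case: h => ->; lra.
have [Sc cyc] : cycle_points S g c by apply/cycle_pointsE.
exists c; split=> //.
  split=> //; exists n, (fun i => iter i g x); split=> // i _.
  by split; [exact: dyn_iter dyn _ _ Sx|split; [exact: dyn_iter dyn i.+1 _ Sx|left]].
move=> y [Sy /joined_coal xy] [m [m0 ym]].
have [i [j e]] := coal_trans cx xy.
have fix_y k : iter (k * m) g y = y by elim: k => // k IH; rewrite mulSn iterD IH.
have -> : y = iter (j * m - j + i) g c.
  by rewrite iterD e -iterD subnK ?fix_y// leq_pmulr.
have [ga gb] := dyn_D dyn Dab.
have := pair_orbit dyn (j * m - j + i) Dab cab.
by case: cab => ->; rewrite ?ga ?gb; intuition.
Qed.

End Exits.
End Levels.

Section DeterministicConnectivity.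
Context {R : realType}.
Variables (S : set R) (gen : generic S).
Let lf := gen_lf gen.
Let nt := gen_nt gen.
Implicit Types (f : nat -> R -> R).

(* Shifts the indices by one: the map acting on level [k] pairs. *)
Definition lev_map f k : R -> R := if k is j.+1 then f j else id.

Definition chn_run f := forall k, is_step S (Level S k) (lev_map f k) (f k).

Lemma nearest_neighbourE x y : S x -> nearest_neighbour S x y <-> Exit (Level S 0) x y.
Proof.
move=> Sx; have E z : Endpt (Level S 0) z <-> S z.
  by split=> [[a [[? <-]|[]]]//|Sz]; exists z; left.
rewrite -(@exitP _ S _ lf nt (lev_sys gen 0) x x)//=; last by left.
split=> [[Sy yx ymin]|[/E Sy yx _ ymin]].
  by split=> //; [exact/E|move=> x' y' x'x /E Sy' y'x _; case: x'x => ->; exact: ymin].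
by split=> // z Sz zx; apply: ymin => //; [left|exact/E].
Qed.

Lemma dyn0 : PairDynamics S (Level S 0) id.
Proof.
split=> //=; first exact: (lev_sys gen 0).
- by move=> a b [_ ->].
- by move=> c x _ _ /ltW.
- by move=> c x _ _ /ltW.
- by move=> x Sx; exists 0%N, x; left.
Qed.

Lemma run_dyn f k : (forall j, (j < k)%N -> is_step S (Level S j) (lev_map f j) (f j)) ->
  PairDynamics S (Level S k) (lev_map f k).
Proof.
elim: k => [_|k IH st]; first exact: dyn0.
by apply: (dyn_step lf nt (IH _) (st _ _) (lev_sys gen k.+1)) => // j jk; apply/st/leqW.
Qed.

Lemma chn_run_step f k : chn_run f -> chn_step S (f k) (f k.+1).
Proof.
move=> run; have dyn := @run_dyn f k.+1 (fun j _ => run j).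
have exE := is_exitE lf nt (lev_sys gen k.+1) dyn (@lev_lt _ _ gen k).
have cyE := cycle_pointsE (lev_sys gen k.+1) dyn (@lev_lt _ _ gen k).
split=> [a /cyE/endpt_pair[u [v [Duv auv]]]|x Sx].
  have [gu gv] := dyn_D dyn Duv; rewrite /= in gu gv.
  have [[l [_ e]]|[r [_ e]]] := ex_cases lf nt (lev_sys gen k.+1) Duv.
    exists v, l; split; last exact/exE.
    by case: auv => ->; rewrite ?gu; [right|left].
  exists u, r; split; last exact/exE.
  by case: auv => ->; rewrite ?gv; [left|right].
have [h1 h2] := run k.+1 _ Sx; split=> [y /exE|h]; first exact: h1.
by apply: h2 => y /exE; exact: h.
Qed.

Lemma chn_runE f : CHN2 S f <-> chn_run f.
Proof.
split=> [[nn st]|run].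
  suff : forall k j, (j < k)%N -> is_step S (Level S j) (lev_map f j) (f j).
    by move=> h j; exact: (h j.+1).
  elim=> // k IH j; rewrite ltnS leq_eqVlt => /orP[/eqP ->|]; last exact: IH.
  case: k {j} IH => [_ x Sx|k IH x Sx].
    have /nearest_neighbourE e := nn _ Sx; have {}e := e Sx.
    split=> [y e'|/(_ (f 0%N x))//].
    exact: (ex_fun (lev_sys gen 0) e e').
  have dyn := run_dyn IH.
  have exE := is_exitE lf nt (lev_sys gen k.+1) dyn (@lev_lt _ _ gen k).
  have [_ [_ /(_ _ Sx)[h1 h2]]] := st k; split=> [y /exE|h]; first exact: h1.
  by apply: h2 => y /exE; exact: h.
split=> [x Sx|k].
  apply/nearest_neighbourE => //.
  have [[l [_ e]]|[l [_ e]]] := @ex_cases _ _ _ lf nt (lev_sys gen 0) x x (conj Sx erefl).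
    by rewrite ((run 0%N _ Sx).1 _ e).
  by rewrite ((run 0%N _ Sx).1 _ e).
split; last exact: chn_run_step.
have dyn := @run_dyn f k.+1 (fun j _ => run j).
exact: (dyn_wellformed lf (lev_sys gen k.+1) dyn (@lev_lt _ _ gen k)).
Qed.

Fixpoint chn_construct k : R -> R := fun x =>
  xget (if k is j.+1 then chn_construct j x else x) [set y | Exit (Level S k) x y].

Lemma chn_construct_run : chn_run chn_construct.
Proof.
move=> k x Sx; have E : chn_construct k x =
    xget (lev_map chn_construct k x) [set y | Exit (Level S k) x y] by case: k.
rewrite E; split=> [y xy|nex]; case: xgetP => [z _ xz|].
- exact: (ex_fun (lev_sys gen k) xz xy).
- by move=> /(_ y).
- by case: (nex z).
- by [].
Qed.

Section Run.
Variables (f : nat -> R -> R) (run : chn_run f).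

Let dyn k : PairDynamics S (Level S k) (lev_map f k) := @run_dyn f k (fun j _ => run j).

Lemma lev_endptS k x : Endpt (Level S k.+1) x -> Endpt (Level S k) x.
Proof. exact: step_endpt. Qed.

Lemma frozen k x : S x -> ~ Endpt (Level S k) x ->
  forall n, (k <= n)%N -> f n x = lev_map f k x.
Proof.
move=> Sx nE; have nE' n : (k <= n)%N -> ~ Endpt (Level S n) x.
  by elim: n => [|n IH]; [rewrite leqn0 => /eqP <-|rewrite leq_eqVlt => /orP[/eqP <-//|];
    rewrite ltnS => /IH h /lev_endptS].
elim=> [|n IH]; first by rewrite leqn0 => /eqP e; subst k; exact: (nonendpt_step (run 0%N) Sx nE).
move=> kn; rewrite (nonendpt_step (run n.+1) Sx (nE' _ kn)).
move: kn; rewrite leq_eqVlt => /orP[/eqP ->//|]; rewrite ltnS => /IH <- //.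
Qed.

Lemma eventually_frozen x : S x -> exists y, eventual_value f x y.
Proof.
move=> Sx; have /existsNP[k nE] : ~ (forall k, Endpt (Level S k) x).
  by move=> h; have : undying S x by []; rewrite undying0.
by exists (lev_map f k x), k; exact: frozen.
Qed.

Lemma EFF_sym x y : EFF_adj S f x y -> EFF_adj S f y x.
Proof. by move=> [? [? [?|?]]]; split=> //; split=> //; [right|left]. Qed.

Lemma edge_joined k x : S x -> joined (EFF_adj S f) x (lev_map f k x).
Proof.
move=> Sx; case: k => [|k]; first exact: joined_refl.
have sys := lev_sys gen k.+1.
have [Ex0|nE] := pselect (Endpt (Level S k.+1) x); last first.
  apply: joined1; split=> //; split; first exact: (dyn_S (dyn k.+1) Sx).
  by left; exists k.+1; exact: frozen.
have [a [b [Dab xab]]] := endpt_pair Ex0; have [Sa Sb _] := sys_in sys Dab.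
have ab : a != b by rewrite lt_eqF// (lev_lt gen Dab).
have [ga gb] := dyn_D (dyn k.+1) Dab.
(* The endpoint which is not the exit keeps its edge forever. *)
suff adj : EFF_adj S f a b.
  case: xab => ->; rewrite ?ga ?gb; first exact: joined1.
  by apply: joined1; exact: EFF_sym.
have stay c : S c -> (forall y, ~ Exit (Level S k.+1) c y) ->
    eventual_value f c (lev_map f k.+1 c).
  move=> Sc nex; exists k.+2; have <- := (run k.+1 Sc).2 nex.
  apply: (@frozen k.+2) => // -[u [h|h]].
    by have [_ /nex] := step_ex h.
  by have [/nex] := step_ex h.
split=> //; split=> //.
have [[l [G e]]|[r [G e]]] := right_or_left lf nt (dyn k.+1) Dab.
  left; rewrite -ga; apply: stay => // y.
  exact: (right_exit_only (dyn k.+1) Dab ab G e).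
right; rewrite -gb; apply: stay => // y.
exact: (left_exit_only (dyn k.+1) Dab ab G e).
Qed.

Lemma iter_joined k n x : S x -> joined (EFF_adj S f) x (iter n (lev_map f k) x).
Proof.
move=> Sx; elim: n => [|n IH]; first exact: joined_refl.
apply: joined_trans IH _; rewrite iterS; apply: edge_joined.
exact: (dyn_iter (dyn k) n Sx).
Qed.

Lemma lev_coal_joined k x y : S x -> S y -> coalesce (lev_map f k) x y ->
  joined (EFF_adj S f) x y.
Proof.
move=> Sx Sy [m [n e]]; apply: joined_trans (iter_joined k m Sx) _.
by rewrite e; apply: joined_sym EFF_sym _; exact: iter_joined.
Qed.

Lemma coal_mono k j x y : S x -> S y -> (k <= j)%N ->
  coalesce (lev_map f k) x y -> coalesce (lev_map f j) x y.
Proof.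
move=> Sx Sy kj xy; rewrite -(subnK kj); elim: (j - k)%N => // n IH.
exact: (coal_step lf nt (dyn (n + k)) (run (n + k)%N) Sx Sy IH).
Qed.

Definition merged x y := exists k, coalesce (lev_map f k) x y.

Lemma merged_trans x y z : S x -> S y -> S z ->
  merged x y -> merged y z -> merged x z.
Proof.
move=> Sx Sy Sz [k xy] [j yz]; exists (maxn k j); apply: (@coal_trans _ _ y).
  exact: coal_mono (leq_maxl _ _) xy.
exact: coal_mono (leq_maxr _ _) yz.
Qed.

Lemma consecutive_merged z z' : S z -> S z' -> z < z' ->
  (forall u, S u -> z < u -> z' <= u) -> merged z z'.
Proof.
move=> Sz Sz' zz' cons; apply: contrapT => nm.
suff key k : exists r l, [/\ LocalMaxGap (Level S k) r l, r <= z, z' <= l,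
    coalesce (lev_map f k) z r & coalesce (lev_map f k) z' l].
  have : surviving S z; last by rewrite surviving0.
  split=> // k; have [r [l [mx rz zl _ _]]] := key k.
  by exists r, l; split=> //; exact: lt_le_trans zl.
suff {}key : exists r l, [/\ Gap (Level S k) r l, r <= z, z' <= l,
    coalesce (lev_map f k) z r & coalesce (lev_map f k) z' l].
  have [r [l [G rz zl cr cl]]] := key; exists r, l; split=> //.
  apply: contrapT => nmax; apply: nm; exists k.+1.
  have [Sr Sl] := gap_in (lev_sys gen k) G.
  have cs := coal_step lf nt (dyn k) (run k).
  apply: (coal_trans (cs _ _ Sz Sr cr)).
  apply: coal_trans (coal_sym (cs _ _ Sz' Sl cl)).
  exact: (not_lmax_coal lf nt (dyn k) (run k) G nmax).
elim: k => [|k [r [l [G rz zl cr cl]]]].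
  exists z, z'; split=> //; try exact: coal_refl.
  by split; [exists z|exists z'| |move=> a b [Sa _]; exact: cons].
have [Sr Sl] := gap_in (lev_sys gen k) G.
have cs := coal_step lf nt (dyn k) (run k).
have [mx|nmax] := pselect (LocalMaxGap (Level S k) r l); last first.
  case: nm; exists k.+1; apply: (coal_trans (cs _ _ Sz Sr cr)).
  apply: coal_trans (coal_sym (cs _ _ Sz' Sl cl)).
  exact: (not_lmax_coal lf nt (dyn k) (run k) G nmax).
have [r' [l' [G' rr' ll' cr' cl']]] :=
  lmax_gap lf nt (dyn k) (run k) (lev_sys gen k.+1) mx.
exists r', l'; split=> //; [lra|lra| |].
  exact: (coal_trans (cs _ _ Sz Sr cr) cr').
exact: (coal_trans (cs _ _ Sz' Sl cl) cl').
Qed.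

Lemma all_merged x y : S x -> S y -> x < y -> merged x y.
Proof.
move=> Sx Sy xy; apply: contrapT => nm.
have [||z [[Sz xz] zy zmax]] :=
  @locally_finite_max _ S [set z | S z /\ merged x z] y lf.
- by move=> z [].
- by exists x => //; split=> //; exists 0%N; exact: coal_refl.
have [||z' [Sz' zz' z'min]] := @locally_finite_min _ S S z lf.
- by [].
- by exists y.
have xz' := merged_trans Sx Sz Sz' xz (consecutive_merged Sz Sz' zz' z'min).
have := z'min _ Sy zy; rewrite le_eqVlt => /orP[/eqP e|z'y].
  by apply: nm; rewrite -e.
by have := zmax z' (conj Sz' xz') z'y; lra.
Qed.

Lemma EFF_joined x y : S x -> S y -> joined (EFF_adj S f) x y.
Proof.
move=> Sx Sy; have [xy|yx|->] := ltgtP x y; last exact: joined_refl.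
  by have [k] := all_merged Sx Sy xy; exact: lev_coal_joined.
apply: joined_sym EFF_sym _.
by have [k] := all_merged Sy Sx yx; exact: lev_coal_joined.
Qed.

End Run.

Theorem generic_connected : CHN2_EFF_connected S.
Proof.
split=> [|f /chn_runE run].
  by exists chn_construct; apply/chn_runE; exact: chn_construct_run.
by split=> [x|x y]; [exact: eventually_frozen|exact: EFF_joined].
Qed.

End DeterministicConnectivity.

(** * The space of locally finite configurations *)

Section Configurations.
Context {R : realType}.

Lemma locally_finite_set0 : locally_finite (set0 : set R).
Proof. by move=> a b; rewrite set0I; exact: finite_set0. Qed.

Record conf := Conf { pts : set R; pts_lf : locally_finite pts }.

HB.instance Definition _ := gen_eqMixin conf.
HB.instance Definition _ := gen_choiceMixin conf.
HB.instance Definition _ := isPointed.Build conf (Conf locally_finite_set0).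

Lemma conf_eq (s t : conf) : pts s = pts t -> s = t.
Proof.
case: s t => S lfS [T lfT] /= e; subst T; congr Conf; exact: Prop_irrelevance.
Qed.

Definition void_event (B : set R) : set conf := [set s | pts s `&` B = set0].

(* The void events form a pi-system, so that a law on configurations is
   determined by its void probabilities (Renyi's theorem). *)
Definition voids : set (set conf) := [set void_event B | B in bounded_borel].

Definition mconf := g_sigma_algebraType voids.

Lemma bounded_borelU (B C : set R) :
  bounded_borel B -> bounded_borel C -> bounded_borel (B `|` C).
Proof.
move=> [mB [M BM]] [mC [N CN]]; split; first exact: measurableU.
exists (Num.max M N) => x [/BM|/CN] /= h; rewrite le_max h ?orbT//.
Qed.

Lemma bounded_borelS (B C : set R) : measurable B -> B `<=` C ->
  bounded_borel C -> bounded_borel B.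
Proof. by move=> mB BC [_ [M CM]]; split=> //; exists M => x /BC/CM. Qed.

Lemma bounded_borel0 : bounded_borel (set0 : set R).
Proof. by split=> //; exists 0. Qed.

Lemma bounded_borel_itv (a b : R) : bounded_borel `[a, b[%classic.
Proof.
split=> //; exists (`|a| + `|b|) => x /=; rewrite in_itv /= => /andP[ax xb].
have := ler_norm b; have := ler_norm (- a); rewrite normrN.
have := normr_ge0 a; have := normr_ge0 b.
by rewrite ler_norml => *; apply/andP; split; lra.
Qed.

Lemma void_measurable (B : set R) : bounded_borel B ->
  measurable (void_event B : set mconf).
Proof. by move=> bB; apply: sub_sigma_algebra; exists B. Qed.

Lemma voidU (B C : set R) : void_event (B `|` C) = void_event B `&` void_event C.
Proof.
apply/seteqP; split=> s; rewrite /void_event /= setIUr setU_eq0 //.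
Qed.

Lemma voids_setI : setI_closed voids.
Proof.
move=> _ _ [B bB <-] [C bC <-]; exists (B `|` C); first exact: bounded_borelU.
exact: voidU.
Qed.

Lemma void0 : void_event set0 = setT.
Proof. by apply/seteqP; split=> // s _; rewrite /void_event /= setI0. Qed.

Lemma measurable_mconf d (T : measurableType d) (X : T -> mconf) :
  (forall B, bounded_borel B -> measurable (X @^-1` void_event B)) ->
  measurable_fun setT X.
Proof.
move=> h; apply: (@measurability _ _ T mconf _ _ voids erefl) => _ [_ [B bB <-] <-].
by rewrite setTI; exact: h.
Qed.

Lemma conf_law_unique d1 d2 (T1 : measurableType d1) (T2 : measurableType d2)
    (m1 : {measure set T1 -> \bar R}) (m2 : {measure set T2 -> \bar R})
    (X : T1 -> mconf) (Y : T2 -> mconf) :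
  measurable_fun setT X -> measurable_fun setT Y -> (m1 setT < +oo)%E ->
  (forall B, bounded_borel B -> m1 (X @^-1` void_event B) = m2 (Y @^-1` void_event B)) ->
  forall E : set mconf, measurable E -> m1 (X @^-1` E) = m2 (Y @^-1` E).
Proof.
move=> mX mY fin h E mE.
have := @measure_unique _ R mconf voids (fun=> setT) erefl voids_setI _ _
  (pushforward m1 X) (pushforward m2 Y).
rewrite /pushforward /=; apply=> //.
- by move=> _; exists set0; [exact: bounded_borel0|exact: void0].
- by rewrite bigcup_const.
- by move=> _ [B bB <-]; exact: h.
Qed.

Lemma preimage_measurable d (T : measurableType d) (X : T -> mconf) (E : set mconf) :
  measurable_fun setT X -> measurable E -> measurable (X @^-1` E).
Proof. by move=> mX mE; rewrite -[_ @^-1` _]setTI; exact: mX. Qed.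

Definition first (q : R) (s : mconf) : R :=
  xget 0 [set x | [/\ pts s x, q <= x & forall y, pts s y -> q <= y -> x <= y]].

Lemma firstP (q : R) (s : mconf) : (exists2 x, pts s x & q <= x) ->
  [/\ pts s (first q s), q <= first q s &
      forall y, pts s y -> q <= y -> first q s <= y].
Proof.
move=> [x0 sx0 qx0].
have [||x [[sx qx] _ xmin]] := @locally_finite_min _ (pts s)
    [set x | pts s x /\ q <= x] (q - 1) (@pts_lf s).
- by move=> x [].
- by exists x0 => //; lra.
rewrite /first; case: xgetP => [//|/(_ x)[]]; split=> // y sy qy.
by apply: xmin => //; lra.
Qed.

Lemma first_uniq (q : R) (s : mconf) x : pts s x -> q <= x ->
  (forall y, pts s y -> q <= y -> x <= y) -> first q s = x.
Proof.
move=> sx qx xmin; have [|h1 h2 h3] := @firstP q s; first by exists x.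
by apply/eqP; rewrite eq_le h3// xmin.
Qed.

Lemma first_rat (s : mconf) x : pts s x -> exists q : rat,
  ratr q <= x /\ first (ratr q) s = x.
Proof.
move=> sx.
have [y yx ymax] : exists2 y, y < x & forall z, pts s z -> z < x -> z <= y.
  have [[z sz zx]|nz] := pselect (exists2 z, pts s z & z < x).
    have [||y [_ yx ymax]] := @locally_finite_max _ _ (pts s) x (@pts_lf s).
    - by [].
    - by exists z.
    by exists y.
  exists (x - 1); first lra.
  by move=> z sz zx; case: nz; exists z.
have [q] := rat_in_itvoo yx; rewrite in_itv /= => /andP[yq qx].
exists q; split; first exact: ltW.
apply: first_uniq => //; first exact: ltW.
move=> z sz qz; rewrite leNgt; apply/negP => zx.
by have := ymax _ sz zx; lra.
Qed.

Definition mpred (F : mconf -> Prop) := measurable ([set s | F s] : set mconf).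

Lemma mp_not F : mpred F -> mpred (fun s => ~ F s).
Proof. by move=> mF; rewrite /mpred (_ : mkset _ = ~` [set s | F s])//; exact: measurableC. Qed.

Lemma mp_and F G : mpred F -> mpred G -> mpred (fun s => F s /\ G s).
Proof. by move=> mF mG; exact: measurableI. Qed.

Lemma mp_or F G : mpred F -> mpred G -> mpred (fun s => F s \/ G s).
Proof. by move=> mF mG; exact: measurableU. Qed.

Lemma mp_ext F G : (forall s, F s <-> G s) -> mpred F -> mpred G.
Proof. by move=> h; rewrite /mpred; congr measurable; apply/seteqP; split=> s /h. Qed.

Lemma mp_and4 F G H K : mpred F -> mpred G -> mpred H -> mpred K ->
  mpred (fun s => [/\ F s, G s, H s & K s]).
Proof.
move=> mF mG mH mK; apply: mp_ext (mp_and (mp_and mF mG) (mp_and mH mK)) => s.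
by split=> [[[? ?] [? ?]]|[]].
Qed.

Lemma mp_and3 F G H : mpred F -> mpred G -> mpred H ->
  mpred (fun s => [/\ F s, G s & H s]).
Proof.
move=> mF mG mH; apply: mp_ext (mp_and mF (mp_and mG mH)) => s.
by split=> [[? [? ?]]|[]].
Qed.

Lemma mp_imp F G : mpred F -> mpred G -> mpred (fun s => F s -> G s).
Proof.
move=> mF mG; apply: mp_ext (mp_or (mp_not mF) mG) => s; split.
  by move=> [nF /nF|].
by have [Fs h|nF _] := pselect (F s); [right; exact: h|left].
Qed.

Lemma mp_cst (p : Prop) : mpred (fun=> p).
Proof.
have [h|h] := pselect p.
  by rewrite /mpred (_ : mkset _ = setT)//; apply/seteqP; split.
by rewrite /mpred (_ : mkset _ = set0)//; apply/seteqP; split.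
Qed.

Lemma mp_ex_nat (F : nat -> mconf -> Prop) : (forall n, mpred (F n)) ->
  mpred (fun s => exists n, F n s).
Proof.
move=> mF; rewrite /mpred (_ : mkset _ = \bigcup_n [set s | F n s]).
  exact: bigcupT_measurable.
by apply/seteqP; split=> [s [n ?]|s [n _ ?]]; exists n.
Qed.

Lemma mp_all_nat (F : nat -> mconf -> Prop) : (forall n, mpred (F n)) ->
  mpred (fun s => forall n, F n s).
Proof.
move=> mF; apply: mp_ext (mp_not (mp_ex_nat (fun n => mp_not (mF n)))) => s.
by rewrite -forallNE; split=> h n; [exact: contrapT|move=> /(_ (h n))].
Qed.

Lemma mp_ex_rat (F : rat -> mconf -> Prop) : (forall q, mpred (F q)) ->
  mpred (fun s => exists q, F q s).
Proof.
move=> mF; rewrite /mpred (_ : mkset _ = \bigcup_q [set s | F q s]).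
  exact: bigcupT_measurable_rat.
by apply/seteqP; split=> [s [n ?]|s [n _ ?]]; exists n.
Qed.

Lemma mp_all_rat (F : rat -> mconf -> Prop) : (forall q, mpred (F q)) ->
  mpred (fun s => forall q, F q s).
Proof.
move=> mF; apply: mp_ext (mp_not (mp_ex_rat (fun n => mp_not (mF n)))) => s.
by rewrite -forallNE; split=> h n; [exact: contrapT|move=> /(_ (h n))].
Qed.

Definition mpoint (p : mconf -> R) := measurable_fun setT p.

Lemma mp_lt p q : mpoint p -> mpoint q -> mpred (fun s => p s < q s).
Proof.
move=> mp mq; have := measurable_fun_ltr mp mq measurableT.
by move=> /(_ [set true] I); rewrite setTI.
Qed.

Lemma mp_le p q : mpoint p -> mpoint q -> mpred (fun s => p s <= q s).
Proof.
move=> mp mq; have := measurable_fun_ler mp mq measurableT.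
by move=> /(_ [set true] I); rewrite setTI.
Qed.

Lemma mp_eq p q : mpoint p -> mpoint q -> mpred (fun s => p s = q s).
Proof.
move=> mp mq; apply: mp_ext (mp_and (mp_le mp mq) (mp_le mq mp)) => s.
by split=> [[h1 h2]|->//]; apply/eqP; rewrite eq_le h1.
Qed.

Lemma mpoint_sub p q : mpoint p -> mpoint q -> mpoint (fun s => p s - q s).
Proof. exact: measurable_funB. Qed.

Lemma mpoint_cst (c : R) : mpoint (fun=> c).
Proof. exact: measurable_cst. Qed.

Lemma mp_hit (a b : R) : mpred (fun s => exists2 x, pts s x & a <= x < b).
Proof.
apply: mp_ext (mp_not (void_measurable (bounded_borel_itv a b))) => s.
rewrite /void_event /=; split=> [/eqP/set0P[x [sx]]|[x sx xab] e].
  by rewrite /= in_itv /= => h; exists x.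
by have : (pts s `&` `[a, b[%classic) x by []; rewrite e.
Qed.

Lemma mp_some (q : R) : mpred (fun s => exists2 x, pts s x & q <= x).
Proof.
apply: mp_ext (mp_ex_nat (fun n => mp_hit q n%:R)) => s; split.
  by move=> [n [x sx /andP[qx _]]]; exists x.
move=> [x sx qx]; exists (Num.truncn `|x|).+1; exists x => //.
by rewrite qx (le_lt_trans (ler_norm x))// truncnS_gt.
Qed.

Lemma mpoint_first (q : R) : mpoint (first q).
Proof.
apply: (@measurability _ _ mconf R _ _ (@RGenInftyO.G R)) => [|_ [_ [t ->] <-]].
  exact: RGenInftyO.measurableE.
rewrite setTI.
apply: (@mp_ext (fun s => (exists2 x, pts s x & q <= x < t) \/
   ((~ exists2 x, pts s x & q <= x) /\ 0 < t))); last first.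
  by apply: mp_or; [exact: mp_hit|apply: mp_and; [apply: mp_not; exact: mp_some|exact: mp_cst]].
move=> s /=; rewrite in_itv /=.
have [ex|nex] := pselect (exists2 x, pts s x & q <= x).
  have [h1 h2 h3] := firstP ex; split=> [[[x sx /andP[qx xt]]|[//]]|h].
    exact: le_lt_trans (h3 _ sx qx) xt.
  by left; exists (first q s); rewrite ?h2.
have -> : first q s = 0.
  by rewrite /first; case: xgetP => // x _ [sx qx _]; case: nex; exists x.
split=> [[[x sx /andP[qx _]]|[]//]|t0]; last by right.
by case: nex; exists x.
Qed.

Lemma mp_ex_pts (F : mconf -> R -> Prop) :
  (forall p, mpoint p -> mpred (fun s => F s (p s))) ->
  mpred (fun s => exists x, pts s x /\ F s x).
Proof.
move=> mF; have h q := mp_and (mp_some q) (mF _ (mpoint_first q)).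
apply: mp_ext (mp_ex_rat (fun q => h (ratr q))) => s.
split=> [[q [/firstP[sf _ _] Fq]]|[x [sx Fx]]]; first by exists (first (ratr q) s).
have [q [qx e]] := first_rat sx; exists q; rewrite e.
by split=> //; exists x.
Qed.

Lemma mp_pts p : mpoint p -> mpred (fun s => pts s (p s)).
Proof.
move=> mp; apply: (@mp_ext (fun s => exists x, pts s x /\ x = p s)).
  by move=> s; split=> [[x [sx <-]]//|]; exists (p s).
by apply: (@mp_ex_pts (fun s x => x = p s)) => q mq; exact: mp_eq.
Qed.

Lemma mp_ex (F : mconf -> R -> Prop) : (forall s x, F s x -> pts s x) ->
  (forall p, mpoint p -> mpred (fun s => F s (p s))) ->
  mpred (fun s => exists x, F s x).
Proof.
move=> Fs mF; apply: mp_ext (mp_ex_pts mF) => s.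
by split=> [[x [_ Fx]]|[x Fx]]; exists x => //; split=> //; exact: Fs.
Qed.

Lemma mp_all (F : mconf -> R -> Prop) : (forall s x, ~ pts s x -> F s x) ->
  (forall p, mpoint p -> mpred (fun s => F s (p s))) ->
  mpred (fun s => forall x, F s x).
Proof.
move=> Fs mF; have h : mpred (fun s => exists x, ~ F s x).
  apply: mp_ex => [s x nF|p mp]; last by apply: mp_not; exact: mF.
  by apply: contrapT => /Fs.
apply: mp_ext (mp_not h) => s; rewrite -forallNE.
by split=> h' n; [exact: contrapT|move=> /(_ (h' n))].
Qed.

Section MeasurableLevels.
Variable D : mconf -> R -> R -> Prop.
Hypothesis D_pts : forall s a b, D s a b -> pts s a /\ pts s b.
Hypothesis mD : forall p q, mpoint p -> mpoint q -> mpred (fun s => D s (p s) (q s)).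

Lemma gap_pts s r l : Gap (D s) r l -> pts s r /\ pts s l.
Proof. by move=> [[a /D_pts[_ ?]] [b /D_pts[? _]] _ _]. Qed.

Lemma mp_gap p q : mpoint p -> mpoint q -> mpred (fun s => Gap (D s) (p s) (q s)).
Proof.
move=> mp mq; apply: mp_and4.
- by apply: mp_ex => [s x /D_pts[]//|x mx]; exact: mD.
- by apply: mp_ex => [s x /D_pts[]//|x mx]; exact: mD.
- exact: mp_lt.
- apply: mp_all => [s x nx b /D_pts[]//|a ma].
  apply: mp_all => [s x nx /D_pts[]//|b mb].
  by apply: mp_imp; [exact: mD|apply: mp_imp; [exact: mp_lt|exact: mp_le]].
Qed.

Lemma mp_step p q : mpoint p -> mpoint q -> mpred (fun s => Step (D s) (p s) (q s)).
Proof.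
move=> mp mq; apply: mp_and3; first exact: mp_gap.
- apply: mp_all => [s x nx b /D_pts[]//|a ma].
  apply: mp_all => [s x nx _ /gap_pts[]//|b mb].
  apply: mp_imp; first exact: mD.
  apply: mp_imp; first exact: mp_gap.
  by apply: mp_lt; exact: mpoint_sub.
- apply: mp_all => [s x nx b /D_pts[]//|a ma].
  apply: mp_all => [s x nx _ /gap_pts[]//|b mb].
  apply: mp_imp; first exact: mD.
  apply: mp_imp; first exact: mp_gap.
  by apply: mp_lt; exact: mpoint_sub.
Qed.

Lemma mp_lmax p q : mpoint p -> mpoint q -> mpred (fun s => LocalMaxGap (D s) (p s) (q s)).
Proof.
move=> mp mq; apply: mp_and3; first exact: mp_gap.
- apply: mp_all => [s x nx b /D_pts[]//|a ma].
  apply: mp_all => [s x nx _ /gap_pts[]//|b mb].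
  apply: mp_imp; first exact: mD.
  apply: mp_imp; first exact: mp_gap.
  by apply: mp_lt; exact: mpoint_sub.
- apply: mp_all => [s x nx b /D_pts[]//|a ma].
  apply: mp_all => [s x nx _ /gap_pts[]//|b mb].
  apply: mp_imp; first exact: mD.
  apply: mp_imp; first exact: mp_gap.
  by apply: mp_lt; exact: mpoint_sub.
Qed.

End MeasurableLevels.

Lemma mp_lev k p q : mpoint p -> mpoint q ->
  mpred (fun s => Level (pts s) k (p s) (q s)).
Proof.
elim: k p q => [|k IH] p q mp mq /=.
  by apply: mp_and; [exact: mp_pts|exact: mp_eq].
by apply: mp_step => // s a b; exact: lev_in.
Qed.

Lemma mp_surviving p : mpoint p -> mpred (fun s => surviving (pts s) (p s)).
Proof.
move=> mp; apply: mp_and; first exact: mp_pts.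
apply: mp_all_nat => k.
have Dp := fun s : mconf => @lev_in _ (pts s) k.
have lp s r l : LocalMaxGap (Level (pts s) k) r l -> pts s r /\ pts s l.
  by move=> [G _ _]; exact: gap_pts Dp _ _ _ G.
apply: mp_ex => [s x [l [/lp[]]]//|r mr].
apply: mp_ex => [s x [/lp[]]//|l ml].
apply: mp_and3; [|exact: mp_le|exact: mp_lt].
by apply: (mp_lmax Dp) => // u v; exact: mp_lev.
Qed.

Lemma mp_undying p : mpoint p -> mpred (fun s => undying (pts s) (p s)).
Proof.
move=> mp; apply: mp_all_nat => k; apply: mp_ex => [s x [Da|Da]|a ma];
  [exact: (lev_in Da).1|exact: (lev_in Da).2|].
by apply: mp_or; exact: mp_lev.
Qed.

Lemma mp_small k t p : mpoint p -> mpred (fun s => small_gaps (pts s) k t (p s)).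
Proof.
move=> mp; have Dp := fun s : mconf => @lev_in _ (pts s) k.
apply: mp_ex => [s x [/(gap_pts Dp)[]]//|q mq].
apply: mp_and; first by apply: (mp_gap Dp) => // u v; exact: mp_lev.
by apply: mp_le; [exact: mpoint_sub|exact: mpoint_cst].
Qed.

Lemma mp_large k t p : mpoint p -> mpred (fun s => large_gaps (pts s) k t (p s)).
Proof.
move=> mp; have Dp := fun s : mconf => @lev_in _ (pts s) k.
apply: mp_ex => [s x [/(gap_pts Dp)[]]//|q mq].
apply: mp_and; first by apply: (mp_gap Dp) => // u v; exact: mp_lev.
by apply: mp_lt; [exact: mpoint_cst|exact: mpoint_sub].
Qed.

End Configurations.

(** * Shift covariance *)

Section Covariance.
Context {R : realType}.
Implicit Types (S A : set R) (D : R -> R -> Prop).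

Definition sh u S : set R := [set x | S (x - u)].
Definition sh2 u D : R -> R -> Prop := fun a b => D (a - u) (b - u).

Lemma shK u S : sh (- u) (sh u S) = S.
Proof. by apply/funext => x; rewrite /sh /= opprK addrK. Qed.

Lemma sh2K u D : sh2 (- u) (sh2 u D) = D.
Proof. by apply/funext => a; apply/funext => b; rewrite /sh2 /= opprK !addrK. Qed.

Definition covariant (A : set R -> set R) := forall u S, A (sh u S) = sh u (A S).

Lemma covariantP (A : set R -> set R) :
  (forall u S x, A (sh u S) x -> A S (x - u)) -> covariant A.
Proof.
move=> h u S; apply/seteqP; split=> x; first exact: h.
rewrite -{1}(shK u S) => hx; have := h (- u) (sh u S) (x - u).
by rewrite opprK subrK; exact.
Qed.

Lemma operator_shift (F : (R -> R -> Prop) -> R -> R -> Prop) :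
  (forall u D a b, F (sh2 u D) a b -> F D (a - u) (b - u)) ->
  forall u D, F (sh2 u D) = sh2 u (F D).
Proof.
move=> h u D; apply/funext => a; apply/funext => b; apply/propext; split.
  exact: h.
rewrite /sh2 -{1}(sh2K u D) => hx; have := h (- u) (sh2 u D) (a - u) (b - u).
by rewrite opprK !subrK; exact.
Qed.

Lemma gap_shift u D : Gap (sh2 u D) = sh2 u (Gap D).
Proof.
apply: operator_shift => {}u {}D r l [[a Da] [b Db] rl gap].
split; [by exists (a - u)|by exists (b - u)|lra|move=> a' b' D' h].
have := gap (a' + u) (b' + u); rewrite /sh2 !addrK => /(_ D').
move=> h'; have : l <= a' + u by apply: h'; lra.
by move=> ?; lra.
Qed.

Lemma step_shift u D : Step (sh2 u D) = sh2 u (Step D).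
Proof.
apply: operator_shift => {}u {}D x y; rewrite /Step gap_shift => -[G h1 h2].
split=> // [a r Da Gr|b l Db Gl].
  by have := h1 (a + u) (r + u); rewrite /sh2 !addrK => /(_ Da Gr); lra.
by have := h2 (b + u) (l + u); rewrite /sh2 !addrK => /(_ Db Gl); lra.
Qed.

Lemma lmax_shift u D : LocalMaxGap (sh2 u D) = sh2 u (LocalMaxGap D).
Proof.
apply: operator_shift => {}u {}D x y; rewrite /LocalMaxGap gap_shift => -[G h1 h2].
split=> // [a r Da Gr|b l Db Gl].
  by have := h1 (a + u) (r + u); rewrite /sh2 !addrK => /(_ Da Gr); lra.
by have := h2 (b + u) (l + u); rewrite /sh2 !addrK => /(_ Db Gl); lra.
Qed.

Lemma lev_shift u S k : Level (sh u S) k = sh2 u (Level S k).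
Proof.
elim: k => [|k /= ->]; last exact: step_shift.
apply/funext => a; apply/funext => b; apply/propext; rewrite /sh2 /sh /=.
split=> [[? <-]//|[? e]]; split=> //.
by lra.
Qed.

Lemma small_cov k t : covariant (fun S => small_gaps S k t).
Proof.
apply: covariantP => u S x [y]; rewrite lev_shift gap_shift => -[G h].
by exists (y - u); split=> //; lra.
Qed.

Lemma large_cov k t : covariant (fun S => large_gaps S k t).
Proof.
apply: covariantP => u S x [y]; rewrite lev_shift gap_shift => -[G h].
by exists (y - u); split=> //; lra.
Qed.

Lemma surviving_cov : covariant (@surviving R).
Proof.
apply: covariantP => u S x [Sx h]; split=> // k; have [r [l []]] := h k.
by rewrite lev_shift lmax_shift => m rx xl; exists (r - u), (l - u); split=> //; lra.
Qed.

Lemma undying_cov : covariant (@undying R).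
Proof.
apply: covariantP => u S x h k; have [a] := h k.
by rewrite lev_shift => -[?|?]; exists (a - u); [left|right].
Qed.

Lemma id_cov : covariant id. Proof. by []. Qed.

Lemma no_ties_shift u S : no_ties S -> no_ties (sh u S).
Proof.
move=> nt x y z w Sx Sy Sz Sw xy yz zw.
have := nt _ _ _ _ Sx Sy Sz Sw.
have -> : y - u - (x - u) = y - x by lra.
have -> : w - u - (z - u) = w - z by lra.
by apply; lra.
Qed.

Definition endless A := ~ (exists x, A x /\ forall y, A y -> y <= x) /\
  ~ (exists x, A x /\ forall y, A y -> x <= y).

Lemma endless_shift u A : endless A -> endless (sh u A).
Proof.
move=> [h1 h2]; split=> -[x [Ax xm]]; [apply: h1|apply: h2]; exists (x - u);
  by split=> // y Ay; have := xm (y + u); rewrite /sh /= addrK => /(_ Ay); lra.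
Qed.

Lemma endless_scattered S A : locally_finite S -> A `<=` S -> endless A ->
  scattered A.
Proof.
move=> lf AS [nmax nmin]; have [->|/set0P[x0 Ax0]] := eqVneq A set0; first by left.
right; split=> M; apply: contrapT => nex.
  have [|x [Ax _ xmax]] := @locally_finite_max _ S A (Num.max M x0 + 1) lf AS.
    exists x0 => //; have : x0 <= Num.max M x0 by rewrite le_max lexx orbT.
    by move=> ?; lra.
  apply: nmax; exists x; split=> // y Ay; apply: xmax => //.
  rewrite ltNge; apply/negP => h; apply: nex; exists y => //.
  have : M <= Num.max M x0 by rewrite le_max lexx.
  by lra.
have [|x [Ax _ xmin]] := @locally_finite_min _ S A (Num.min M x0 - 1) lf AS.
  exists x0 => //; have : Num.min M x0 <= x0 by rewrite ge_min lexx orbT.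
  by move=> ?; lra.
apply: nmin; exists x; split=> // y Ay; apply: xmin => //.
rewrite ltNge; apply/negP => h; apply: nex; exists y => //.
have : Num.min M x0 <= M by rewrite ge_min lexx.
by lra.
Qed.

Record tame S : Prop := Tame {
  tame_nt : no_ties S;
  tame_S : endless S;
  tame_small : forall k (q : rat), endless (small_gaps S k (ratr q));
  tame_large : forall k (q : rat), endless (large_gaps S k (ratr q));
  tame_surviving : endless (surviving S);
  tame_undying : endless (undying S) }.

Lemma tame_shift u S : tame S -> tame (sh u S).
Proof.
move=> [nt h1 h2 h3 h4 h5]; split.
- exact: no_ties_shift.
- exact: endless_shift.
- by move=> k q; rewrite small_cov; exact: endless_shift.
- by move=> k q; rewrite large_cov; exact: endless_shift.
- by rewrite surviving_cov; exact: endless_shift.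
- by rewrite undying_cov; exact: endless_shift.
Qed.

Lemma small_sub S k t : small_gaps S k t `<=` S.
Proof. by move=> x [y [[[a Da] _ _ _] _]]; exact: (lev_in Da).2. Qed.

Lemma large_sub S k t : large_gaps S k t `<=` S.
Proof. by move=> x [y [[[a Da] _ _ _] _]]; exact: (lev_in Da).2. Qed.

Lemma surviving_sub S : surviving S `<=` S. Proof. by move=> x []. Qed.

Lemma undying_sub S : undying S `<=` S.
Proof. by move=> x /(_ 0%N)[a [Da|Da]]; [exact: (lev_in Da).2|exact: (lev_in Da).1]. Qed.

Lemma tame_generic S : locally_finite S -> S !=set0 -> tame S -> generic S.
Proof.
move=> lf ne [nt h1 h2 h3 h4 h5]; split=> //.
- exact: endless_scattered lf _ h1.
- by move=> k q; apply: endless_scattered lf _ (h2 k q); exact: small_sub.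
- by move=> k q; apply: endless_scattered lf _ (h3 k q); exact: large_sub.
- by apply: endless_scattered lf _ h4; exact: surviving_sub.
- by apply: endless_scattered lf _ h5; exact: undying_sub.
Qed.

Definition point_process_family (A : set R -> set R) :=
  [/\ covariant A, forall S, A S `<=` S &
      forall p, mpoint p -> mpred (fun s => A (pts s) (p s))].

Lemma mp_endless (A : set R -> set R) : point_process_family A -> mpred (fun s => endless (A (pts s))).
Proof.
move=> [_ As mA]; apply: mp_and; apply: mp_not.
  apply: mp_ex => [s x [/As]//|p mp]; apply: mp_and; first exact: mA.
  apply: mp_all => [s x nx /As//|q mq]; apply: mp_imp; first exact: mA.
  exact: mp_le.
apply: mp_ex => [s x [/As]//|p mp]; apply: mp_and; first exact: mA.
apply: mp_all => [s x nx /As//|q mq]; apply: mp_imp; first exact: mA.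
exact: mp_le.
Qed.

Lemma family_id : point_process_family id.
Proof. by split; [exact: id_cov|move=> S x|move=> p mp; exact: (mp_pts mp)]. Qed.

Lemma family_small k t : point_process_family (fun S => small_gaps S k t).
Proof. by split; [exact: small_cov|move=> S; exact: small_sub|move=> p; exact: mp_small]. Qed.

Lemma family_large k t : point_process_family (fun S => large_gaps S k t).
Proof. by split; [exact: large_cov|move=> S; exact: large_sub|move=> p; exact: mp_large]. Qed.

Lemma family_surviving : point_process_family (@surviving R).
Proof. by split; [exact: surviving_cov|exact: surviving_sub|move=> p; exact: mp_surviving]. Qed.

Lemma family_undying : point_process_family (@undying R).
Proof. by split; [exact: undying_cov|exact: undying_sub|move=> p; exact: mp_undying]. Qed.

Lemma mp_no_ties : mpred (fun s : @mconf R => no_ties (pts s)).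
Proof.
apply: mp_all => [s x nx y z w //|x mx].
apply: mp_all => [s y ny z w _ //|y my].
apply: mp_all => [s z nz w _ _ //|z mz].
apply: mp_all => [s w nw _ _ _ //|w mw].
do 4![apply: mp_imp; first exact: mp_pts].
apply: mp_imp; first exact: mp_lt.
apply: mp_imp; first exact: mp_le.
apply: mp_imp; first exact: mp_lt.
apply: (@mp_ext _ (fun s => ~ (y s - x s = w s - z s))).
  by move=> s; split=> [/eqP|/eqP].
by apply: mp_not; apply: mp_eq; exact: mpoint_sub.
Qed.

Lemma mp_tame : mpred (fun s : @mconf R => tame (pts s)).
Proof.
have h := mp_and (mp_and3 mp_no_ties (mp_endless family_id)
    (mp_all_nat (fun k => mp_all_rat (fun q => mp_endless (family_small k (ratr q))))))
  (mp_and3 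
    (mp_all_nat (fun k => mp_all_rat (fun q => mp_endless (family_large k (ratr q)))))
    (mp_endless family_surviving) (mp_endless family_undying)).
by apply: mp_ext h => s; split=> [[[? ? ?] [? ? ?]]|[? ? ? ? ? ?]]; split.
Qed.

Lemma sh_locally_finite u S : locally_finite S -> locally_finite (sh u S).
Proof.
move=> lf a b.
apply: sub_finite_set (finite_image (fun x => x + u) (lf (a - u) (b - u))).
move=> x /= [Sx /andP[ax xb]]; exists (x - u); last by rewrite subrK.
by split=> //=; apply/andP; split; lra.
Qed.

Definition shift_conf u (s : mconf) : mconf := Conf (sh_locally_finite u (@pts_lf R s)).

Lemma bounded_borel_shift u (B : set R) : bounded_borel B ->
  bounded_borel [set x | B (x + u)].
Proof.
move=> [mB [M BM]]; split.
  have mu : measurable_fun setT (fun x : R => x + u).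
    by apply: measurable_funD => //; exact: measurable_cst.
  by rewrite -[mkset _]setTI; exact: mu.
exists (M + `|u|) => x /BM /= h.
have := ler_normB (x + u) u; rewrite addrK; lra.
Qed.

Lemma shift_void u (B : set R) :
  shift_conf u @^-1` void_event B = void_event [set x | B (x + u)].
Proof.
apply/seteqP; split=> s; rewrite /void_event /= => /seteqP[h _].
  apply/seteqP; split=> // x /= [sx Bx]; apply: (h (x + u)).
  by split=> //; rewrite /sh /= addrK.
apply/seteqP; split=> // x /= [sx Bx]; apply: (h (x - u)).
by split=> //; rewrite /= subrK.
Qed.

Lemma measurable_shift u : measurable_fun setT (shift_conf u).
Proof.
apply: measurable_mconf => B bB; rewrite shift_void.
by apply: void_measurable; exact: bounded_borel_shift.
Qed.

Lemma lebesgue_shift u (B : set R) : measurable B ->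
  lebesgue_measure [set x | B (x + u)] = lebesgue_measure B.
Proof.
move=> mB; pose f := (fun x : R => x + u) : R -> measurableTypeR R.
have mf : measurable_fun setT f.
  by apply: measurable_funD => //; exact: measurable_cst.
have := @lebesgue_measure_unique R (pushforward lebesgue_measure f) _ B mB.
rewrite /pushforward /= => ->//.
move=> _ [[a b]] _ <-.
rewrite /pushforward (_ : f @^-1` _ = `]a - u, b - u]%classic); last first.
  apply/seteqP; split=> x; rewrite /= !in_itv /= /f => /andP[? ?]; apply/andP; split; lra.
rewrite !lebesgue_measure_itv /= !lte_fin.
have -> : (a - u < b - u) = (a < b) by apply/idP/idP; lra.
by case: ifP => // _; rewrite -!EFinB; congr EFin; lra.
Qed.

End Covariance.

(** * The Poisson process *)

Section PoissonProcess.
Context {R : realType}.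

Lemma archimedean_le0 (r c : R) : (forall n : nat, r * n%:R <= c) -> r <= 0.
Proof.
move=> h; rewrite leNgt; apply/negP => r0.
have := h (Num.truncn (c / r)).+1; apply/negP; rewrite -ltNge.
by rewrite mulrC -ltr_pdivrMr// truncnS_gt.
Qed.

Lemma count_is0 (A : set R) : count_is A 0 <-> A = set0.
Proof.
split=> [[s [_ <- /size0nil ->]]|->]; first by apply/seteqP; split.
by exists [::]; split=> //; apply/seteqP; split.
Qed.

Lemma poisson_prob0 (m : R) : Defs.poisson_prob m 0 = expR (- m).
Proof. by rewrite /Defs.poisson_prob expr0 fact0 divr1 mul1r. Qed.

Lemma poisson_prob1 (m : R) : Defs.poisson_prob m 1 = m * expR (- m).
Proof. by rewrite /Defs.poisson_prob expr1 divr1. Qed.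

Local Notation leb := (@lebesgue_measure R).
Definition vol (B : set R) : R := fine (leb B).

Lemma vol_fin (B : set R) : bounded_borel B -> leb B = (vol B)%:E.
Proof.
move=> [mB [M BM]]; rewrite /vol fineK// ge0_fin_numE//.
apply: (@le_lt_trans _ _ (leb `[(- M), M]%classic)).
  apply: le_measure; rewrite ?inE// => x /BM /=.
  by rewrite in_itv /= ler_norml.
by rewrite lebesgue_measure_itv /= lte_fin; case: ifP => // _; rewrite -EFinB ltry.
Qed.

Lemma volU (B C : set R) : bounded_borel B -> bounded_borel C ->
  B `&` C = set0 -> vol (B `|` C) = vol B + vol C.
Proof.
move=> bB bC BC; have [mB _] := bB; have [mC _] := bC.
have : leb (B `|` C) = (leb B + leb C)%E by exact: measureU.
rewrite (vol_fin (bounded_borelU bB bC)) (vol_fin bB) (vol_fin bC).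
by move=> [].
Qed.

Lemma vol_itv (a b : R) : a < b -> vol `[a, b[%classic = b - a.
Proof. by move=> ab; rewrite /vol lebesgue_measure_itv /= lte_fin ab. Qed.

Variables (d : measure_display) (T : measurableType d).
Variables (P : probability T R) (lam : R) (Phi : T -> set R).
Hypothesis PP : PoissonPP P lam Phi.

Let lam_gt0 : 0 < lam. Proof. by case: PP. Qed.

Lemma phi_lf w : locally_finite (Phi w).
Proof. by case: PP => _ lf _ _ a b; exact: lf. Qed.

Definition phi (w : T) : mconf := Conf (phi_lf w).

Lemma phi_void (B : set R) :
  phi @^-1` void_event B = [set w | count_is (Phi w `&` B) 0].
Proof. by apply/seteqP; split=> w /count_is0. Qed.

Lemma measurable_phi : measurable_fun setT phi.
Proof.
apply: measurable_mconf => B bB; rewrite phi_void.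
by case: PP => _ _ mP _; exact: mP.
Qed.

Lemma void_prob (B : set R) : bounded_borel B ->
  P (phi @^-1` void_event B) = (expR (- (lam * vol B)))%:E.
Proof.
move=> bB; rewrite phi_void; case: PP => _ _ _ /(_ 1%N (fun=> B) (fun=> 0%N)).
rewrite big_ord1 poisson_prob0 => <- //; last first.
  by move=> i j; rewrite !ord1.
congr (P _); apply/seteqP; split=> [w h i _|w] //=.
by move=> /(_ ord0 I).
Qed.

Lemma law_shift u (E : set mconf) : measurable E ->
  P ((shift_conf u \o phi) @^-1` E) = P (phi @^-1` E).
Proof.
move=> mE; apply: conf_law_unique => //.
- by apply: measurableT_comp; [exact: measurable_shift|exact: measurable_phi].
- exact: measurable_phi.
- exact: le_lt_trans (probability_le1 _ measurableT) (ltry _).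
move=> B bB; have bB' := bounded_borel_shift u bB; have [mB _] := bB.
have e : P ((shift_conf u \o phi) @^-1` void_event B) = (expR (- (lam * vol B)))%:E.
  by rewrite comp_preimage shift_void void_prob// /vol lebesgue_shift.
exact: etrans e (esym (void_prob bB)).
Qed.

Lemma negligible_countable (K : countType) (F : K -> set T) :
  (forall q, P.-negligible (F q)) -> P.-negligible (\bigcup_q F q).
Proof.
move=> nF; pose G n := if @unpickle K n is Some q then F q else set0.
apply: (@negligibleS _ _ _ _ (\bigcup_n G n)).
  by move=> w [q _ Fw]; exists (pickle q); rewrite ?/G ?pickleK.
apply: negligible_bigcup => n; rewrite /G.
by case: unpickle => [q|]; [exact: nF|exact: negligible_set0].
Qed.

(* A uniquely determined point of a stationary process would be uniformly
   distributed on the line. *)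
Lemma unique_point_null (Q : set R -> set R) : point_process_family Q ->
  (forall S x y, Q S x -> Q S y -> x = y) ->
  P.-negligible [set w | exists x, Q (Phi w) x].
Proof.
move=> [cov Qs mQ] uniqQ.
pose W (a M : R) : set mconf := [set s | exists x, Q (pts s) x /\ a <= x < a + M].
have mW a M : measurable (W a M).
  apply: (@mp_ex _ (fun s x => Q (pts s) x /\ a <= x < a + M)) => [s x [/Qs]//|p mp].
  apply: mp_and; first exact: mQ.
  apply: (@mp_ext _ (fun s => a <= p s /\ p s < a + M)).
    by move=> s; split=> [[-> ->]//|/andP[]].
  by apply: mp_and; [apply: mp_le|apply: mp_lt] => //; exact: mpoint_cst.
have Wshift a u M : shift_conf u @^-1` W (a + u) M = W a M.
  apply/seteqP; split=> s [x]; rewrite ?cov => -[Qx /andP[h1 h2]].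
    by exists (x - u); split=> //; apply/andP; split; lra.
  exists (x + u); rewrite /= cov /sh /= addrK; split=> //.
  by apply/andP; split; lra.
have W0 a M : 0 < M -> P (phi @^-1` W a M) = 0%E.
  move=> M0; pose F n := phi @^-1` W (a + n%:R * M) M.
  have mF n : measurable (F n) by exact: preimage_measurable measurable_phi (mW _ _).
  have PF n : P (F n) = P (phi @^-1` W a M).
    by rewrite -(Wshift a (n%:R * M)) -comp_preimage law_shift.
  have tF : trivIset setT F.
    apply/trivIsetP => i j _ _ ij; apply/seteqP; split=> // w [[x [Qx xi]] [y [Qy yj]]].
    move: ij; rewrite (uniqQ _ _ _ Qx Qy) in xi.
    wlog ij : i j xi yj / (i < j)%N.
      move=> th ij; have := ij; rewrite neq_ltn => /orP[lt|lt]; first exact: (th i j).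
      by apply: (th j i) => //; rewrite eq_sym.
    move=> _; move: xi yj => /andP[_ xi] /andP[yj _].
    have : (i.+1%:R : R) <= j%:R by rewrite ler_nat.
    by rewrite -natr1 => h; nra.
  have p_fin : P (phi @^-1` W a M) = (fine (P (phi @^-1` W a M)))%:E.
    rewrite fineK// fin_num_measure//; exact: preimage_measurable measurable_phi (mW _ _).
  set r := fine _ in p_fin; rewrite p_fin; congr EFin.
  have r0 : 0 <= r by rewrite -lee_fin -p_fin.
  apply/eqP; rewrite eq_le r0 andbT; apply: (@archimedean_le0 r 1) => n.
  have : P (\big[setU/set0]_(i < n) F i) = (\sum_(i < n) P (F i))%E.
    exact: measure_bigsetU.
  under [in X in _ = X]eq_bigr do rewrite PF p_fin.
  rewrite sumEFin sumr_const card_ord mulr_natr => e.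
  rewrite -lee_fin -e; apply: probability_le1.
  by apply: bigsetU_measurable => i _; exact: mF.
apply: (@negligibleS _ _ _ _ (\bigcup_n (phi @^-1` W (- n.+1%:R) (n.+1%:R + n.+1%:R)))).
  move=> w [x Qx]; exists (Num.truncn `|x|) => //; exists x; split=> //.
  have := @truncnS_gt _ `|x|; set N := _%:R; rewrite ltr_norml => /andP[? ?].
  by apply/andP; split; lra.
apply: negligible_bigcup => n; apply/negligibleP.
  exact: preimage_measurable measurable_phi (mW _ _).
by apply: W0; rewrite addr_gt0.
Qed.

Lemma endless_ae (A : set R -> set R) : point_process_family A ->
  {ae P, forall w, endless (A (Phi w))}.
Proof.
move=> [cov As mA].
have fmax : point_process_family
    (fun S => [set x | A S x /\ forall y, A S y -> y <= x]).
  split=> [|S x [/As]//|p mp].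
    apply: covariantP => u S x; rewrite cov => -[Ax xmax]; split=> // y Ay.
    by have := xmax (y + u); rewrite /sh /= addrK => /(_ Ay); lra.
  apply: mp_and; first exact: mA.
  apply: mp_all => [s x nx /As//|q mq]; apply: mp_imp; first exact: mA.
  exact: mp_le.
have fmin : point_process_family
    (fun S => [set x | A S x /\ forall y, A S y -> x <= y]).
  split=> [|S x [/As]//|p mp].
    apply: covariantP => u S x; rewrite cov => -[Ax xmax]; split=> // y Ay.
    by have := xmax (y + u); rewrite /sh /= addrK => /(_ Ay); lra.
  apply: mp_and; first exact: mA.
  apply: mp_all => [s x nx /As//|q mq]; apply: mp_imp; first exact: mA.
  exact: mp_le.
have n1 := unique_point_null fmax; have n2 := unique_point_null fmin.
apply: negligibleS (negligibleU (n1 _) (n2 _)).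
- move=> w /= /not_andP[/contrapT[x ?]|/contrapT[x ?]]; [left|right]; by exists x.
- move=> S x y [Ax xm] [Ay ym]; apply/eqP; rewrite eq_le.
  by rewrite (ym _ Ax) (xm _ Ay).
- move=> S x y [Ax xm] [Ay ym]; apply/eqP; rewrite eq_le.
  by rewrite (ym _ Ax) (xm _ Ay).
Qed.

Section Insertion.
Variables (a b : R).
Hypothesis ab : a < b.
Let I : set R := `[a, b[%classic.
Let bI : bounded_borel I. Proof. exact: bounded_borel_itv. Qed.
Let mI : measurable I. Proof. by case: bI. Qed.

Lemma replace_locally_finite S u :
  locally_finite S -> locally_finite (S `\` I `|` [set u] : set R).
Proof.
move=> lf x y; rewrite setIUl finite_setU; split.
  by apply: sub_finite_set (lf x y) => z [[]].
by apply: sub_finite_set (finite_set1 u) => z [].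
Qed.

Definition replace (u : R) (s : mconf) : mconf :=
  Conf (replace_locally_finite u (@pts_lf R s)).

Lemma replace_void u (B : set R) :
  replace u @^-1` void_event B = [set s | void_event (B `\` I) s /\ ~ B u].
Proof.
apply/seteqP; split=> s; rewrite /void_event /=.
  move=> /seteqP[h _]; split; last by move=> Bu; apply: (h u); split=> //; right.
  by apply/seteqP; split=> // x [sx [Bx nIx]]; apply: (h x); split=> //; left.
move=> [/seteqP[h _] nBu]; apply/seteqP; split=> // x [[[sx nIx]|/= -> //] Bx].
by apply: (h x).
Qed.

Lemma bounded_borelDI (B : set R) : bounded_borel B -> bounded_borel (B `\` I).
Proof.
move=> bB; apply: bounded_borelS (bB); last by move=> x [].
by apply: measurableD => //; case: bB.
Qed.

Lemma measurable_replace u : measurable_fun setT (replace u).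
Proof.
apply: measurable_mconf => B bB; rewrite replace_void.
apply: mp_and; last exact: mp_cst.
by apply: void_measurable; exact: bounded_borelDI.
Qed.

Definition insert (z : T * measurableTypeR R) : mconf := replace z.2 (phi z.1).

Lemma insert_void (B : set R) :
  insert @^-1` void_event B = (phi @^-1` void_event (B `\` I)) `*` (~` B).
Proof.
apply/seteqP; split=> -[w u] /=.
  by move=> h; have : (replace u @^-1` void_event B) (phi w) by []; rewrite replace_void.
by move=> h; have : (replace u @^-1` void_event B) (phi w) by rewrite replace_void.
Qed.

Lemma measurable_insert : measurable_fun setT insert.
Proof.
apply: measurable_mconf => B bB; rewrite insert_void; apply: measurableX.
  apply: preimage_measurable measurable_phi _.
  by apply: void_measurable; exact: bounded_borelDI.
by apply: measurableC; case: bB.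
Qed.

Definition single : set T := [set w | count_is (Phi w `&` I) 1].

Lemma measurable_single : measurable single.
Proof. by case: PP => _ _ mP _; exact: mP. Qed.

Let mTI : measurable ([set: T] `*` (I : set (measurableTypeR R))).
Proof. exact: measurableX. Qed.

Lemma single_void (B : set R) : bounded_borel B ->
  P (phi @^-1` void_event B `&` single) =
  (expR (- (lam * vol B)) * (lam * vol (I `\` B) * expR (- (lam * vol (I `\` B)))))%:E.
Proof.
move=> bB; case: PP => _ _ _ pp.
have := pp 2%N (fun i => if i == 0 then B else I `\` B) (fun i => if i == 0 then 0%N else 1%N).
rewrite big_ord_recl big_ord1 poisson_prob0 poisson_prob1.
move=> <-.
- have IB w : Phi w `&` B = set0 -> Phi w `&` (I `\` B) = Phi w `&` I.
    move=> h; apply/seteqP; split=> x [Px]; first by move=> [Ix _].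
    move=> Ix; split=> //; split=> // Bx.
    by have : (Phi w `&` B) x by []; rewrite h.
  congr (P _); apply/seteqP; split=> w.
    move=> [h s1] i _ /=; case: ifP => _; first exact/count_is0.
    by rewrite IB.
  move=> h; have /count_is0 h0 := h ord0 Logic.I.
  by split; [exact: h0|have := h (lift ord0 ord0) Logic.I; rewrite /= IB].
- move=> i; case: ifP => // _; apply: bounded_borelS (bI); last by move=> x [].
  by apply: measurableD => //; case: bB.
- move=> [[|[|//]] i2] [[|[|//]] j2] //= _; apply/seteqP; split=> // x [] //.
    by move=> Bx [].
  by move=> [].
Qed.

Lemma insertion (m : {measure set (T * measurableTypeR R) -> \bar R}) :
  (forall (A : set T) (B : set (measurableTypeR R)),
    measurable A -> measurable B -> m (A `*` B) = (P A * leb B)%E) ->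
  forall E : set mconf, measurable E ->
  P (phi @^-1` E `&` single) =
  ((lam * expR (- (lam * (b - a))))%:E * m (insert @^-1` E `&` ([set: T] `*` I)))%E.
Proof.
move=> hm E mE.
have c0 : 0 <= lam * expR (- (lam * (b - a))) by rewrite mulr_ge0 ?expR_ge0// ltW.
have := @conf_law_unique R _ _ _ _ (mrestr P measurable_single)
  (mscale (NngNum c0) (mrestr m mTI)) _ _ measurable_phi measurable_insert.
apply=> //.
  have : (P (setT `&` single) < +oo)%E; last by [].
  rewrite setTI; exact: le_lt_trans (probability_le1 _ measurable_single) (ltry _).
move=> B bB; suff : P (phi @^-1` void_event B `&` single) =
    ((lam * expR (- (lam * (b - a))))%:E *
     m (insert @^-1` void_event B `&` ([set: T] `*` I)))%E by [].
have [mB _] := bB.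
have bBI := bounded_borelDI bB.
have bIB : bounded_borel (I `\` B).
  by apply: bounded_borelS (bI); [exact: measurableD|move=> x []].
rewrite single_void// insert_void -setXI setIT (_ : ~` B `&` I = I `\` B); last first.
  by rewrite setIC setDE.
rewrite hm; last 2 first.
- apply: preimage_measurable measurable_phi _; exact: void_measurable.
- by case: bIB.
rewrite void_prob// (vol_fin bIB) -!EFinM; congr EFin.
have : vol B + vol (I `\` B) = (b - a) + vol (B `\` I).
  rewrite -(vol_itv ab) -!volU//.
  - congr vol; apply/seteqP; split=> x /=;
      by have [?|?] := pselect (B x); have [?|?] := pselect (I x); tauto.
  - by apply/seteqP; split=> // x [Ix []].
  - by apply/seteqP; split=> // x [Bx []].
move=> e; rewrite [RHS](_ : _ = lam * vol (I `\` B) *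
   (expR (- (lam * (b - a))) * expR (- (lam * vol (B `\` I))))); last by ring.
rewrite [LHS](_ : _ = lam * vol (I `\` B) *
   (expR (- (lam * vol B)) * expR (- (lam * vol (I `\` B))))); last by ring.
rewrite -!expRD; congr (_ * expR _); rewrite -!mulrN -!mulrDr; congr (_ * _).
by lra.
Qed.

Definition tie_at (s : mconf) (x : R) := exists y z w,
  [/\ [/\ pts s x, pts s y, pts s z & pts s w],
      [/\ I x, ~ I y, ~ I z & ~ I w] & y - x = w - z].

Lemma mp_tie : mpred (fun s => exists x, tie_at s x).
Proof.
have mp_I p : mpoint p -> mpred (fun s => I (p s)).
  move=> mp; apply: (@mp_ext _ (fun s => a <= p s /\ p s < b)).
    by move=> s; rewrite /I /= in_itv /=; split=> [[-> ->]//|/andP[]].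
  by apply: mp_and; [apply: mp_le|apply: mp_lt] => //; exact: mpoint_cst.
apply: mp_ex => [s x [y [z [w [[]]]]]//|x mx].
apply: mp_ex => [s y [z [w [[]]]]//|y my].
apply: mp_ex => [s z [w [[]]]//|z mz].
apply: mp_ex => [s w [[]]//|w mw].
apply: mp_and3; last by apply: mp_eq; exact: mpoint_sub.
  by apply: mp_and4; exact: mp_pts.
by apply: mp_and4; [exact: mp_I|apply: mp_not; exact: mp_I|
  apply: mp_not; exact: mp_I|apply: mp_not; exact: mp_I].
Qed.

Lemma phi_countable w : countable (Phi w).
Proof.
have -> : Phi w = \bigcup_n (Phi w `&` [set x | - n%:R <= x <= n%:R]).
  apply/seteqP; split=> [x Px|x [n _ []//]].
  exists (Num.truncn `|x|).+1 => //; split=> //=.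
  by rewrite -ler_norml ltW// truncnS_gt.
by apply: bigcup_countable => // n _; apply: finite_set_countable; exact: phi_lf.
Qed.

Lemma tie_null : P.-negligible (single `&` [set w | exists x, tie_at (phi w) x]).
Proof.
pose E : set mconf := [set s | exists x, tie_at s x].
have mE : measurable E := mp_tie.
apply/negligibleP.
  apply: measurableI; first exact: measurable_single.
  exact: preimage_measurable measurable_phi mE.
rewrite setIC; suff : P (phi @^-1` E `&` single) = 0%E by [].
rewrite (insertion (m := (P \x lebesgue_measure)%E)) //; last first.
  by move=> A B mA mB; exact: product_measure1E.
set A := _ `&` _; suff A0 : (P \x lebesgue_measure)%E A = 0%E.
  by apply: etrans (mule0 _); congr (_ * _)%E; exact: A0.
rewrite /product_measure1; apply: integral0_eq => w _ /=.
apply: countable_lebesgue_measure0.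
pose g (c : R * (R * R)) := c.1 - (c.2.2 - c.2.1).
have cg : countable (g @` (Phi w `*` (Phi w `*` Phi w))).
  apply: sub_countable (card_image_le _ _) _; apply: countableX; first exact: phi_countable.
  by apply: countableX; exact: phi_countable.
apply: sub_countable cg; apply: subset_card_le => u; rewrite /xsection /= inE.
move=> [[x [y [z [t [[sx sy sz st] [Ix Iy Iz It] e]]]]] [_ Iu]].
have ux : x = u by case: sx => [[]|].
have inP v : pts (insert (w, u)) v -> ~ I v -> Phi w v.
  by move=> [[]//|/= ->].
exists (y, (z, t)); first by split; [|split]; exact: inP.
by rewrite /g /= -e ux; lra.
Qed.

End Insertion.

Lemma no_ties_ae : {ae P, forall w, no_ties (Phi w)}.
Proof.
pose F (c : rat * rat) : set T := if ratr c.1 < ratr c.2 :> R then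
  single (ratr c.1) (ratr c.2) `&`
    [set w | exists x, tie_at (ratr c.1) (ratr c.2) (phi w) x] else set0.
have nF c : P.-negligible (F c).
  by rewrite /F; case: ifP => [lt|_]; [exact: tie_null|exact: negligible_set0].
apply: negligibleS (negligible_countable nF) => w /= nt.
apply: contrapT => nw; apply: nt => x y z t Sx Sy Sz St xy yz zt.
apply/negP => /eqP e; apply: nw.
have [q [qx qfirst]] := @first_rat R (phi w) x Sx.
have [||y0 [Sy0 xy0 y0min]] := @locally_finite_min _ (Phi w) (Phi w) x (@phi_lf w).
- by [].
- by exists y.
have [q'] := rat_in_itvoo xy0; rewrite in_itv /= => /andP[xq' q'y0].
exists (q, q') => //; rewrite /F /= (le_lt_trans qx xq').
have y0y := y0min _ Sy xy.
have nI v : y0 <= v -> ~ `[ratr q, ratr q'[%classic v.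
  by move=> h; rewrite /= in_itv /= => /andP[_]; lra.
split.
  exists [:: x]; split=> //; apply/seteqP; split=> v /=.
    rewrite inE => /eqP ->; split=> //.
    by rewrite /= in_itv /= qx.
  rewrite in_itv /= inE => -[Sv /andP[qv vq']].
  have [_ _ /(_ _ Sv qv)] := @firstP R (ratr q) (phi w) (ex_intro2 _ _ x Sx qx).
  rewrite qfirst le_eqVlt => /orP[/eqP ->//|xv].
  by have := y0min _ Sv xv; lra.
exists x, y, z, t; split=> //; split; [|apply: nI; lra..].
by rewrite /= in_itv /= qx.
Qed.

Lemma tame_ae : {ae P, forall w, tame (Phi w)}.
Proof.
have rat_ae (A : nat -> rat -> set R -> set R) :
    (forall k q, point_process_family (A k q)) ->
    {ae P, forall w, forall k q, endless (A k q (Phi w))}.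
  move=> fam; pose F (c : nat * rat) : set T := ~` [set w | endless (A c.1 c.2 (Phi w))].
  apply: negligibleS (@negligible_countable _ F _) => [w /= h|c].
    apply: contrapT => nw; apply: h => k q; apply: contrapT => ne.
    by apply: nw; exists (k, q).
  exact: endless_ae.
have h1 := no_ties_ae; have h2 := endless_ae family_id.
have h3 := rat_ae _ (fun k q => family_small k (ratr q)).
have h4 := rat_ae _ (fun k q => family_large k (ratr q)).
have h5 := endless_ae family_surviving; have h6 := endless_ae family_undying.
have h12 := negligibleU h1 h2; have h34 := negligibleU h3 h4.
have h56 := negligibleU h5 h6.
apply: negligibleS (negligibleU h12 (negligibleU h34 h56)) => w /= nt.
apply: contrapT => /not_orP[/not_orP[/contrapT ? /contrapT ?]].
move=> /not_orP[/not_orP[/contrapT ? /contrapT ?] /not_orP[/contrapT ? /contrapT ?]].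
by apply: nt; split.
Qed.

Lemma add0_locally_finite S : locally_finite S ->
  locally_finite (S `|` [set 0] : set R).
Proof.
move=> lf x y; rewrite setIUl finite_setU; split; first exact: lf.
by apply: sub_finite_set (finite_set1 0) => z [].
Qed.

Definition add0 (s : mconf) : mconf := Conf (add0_locally_finite (@pts_lf R s)).

Lemma measurable_add0 : measurable_fun setT add0.
Proof.
apply: measurable_mconf => B bB.
apply: (@mp_ext _ (fun s => void_event B s /\ ~ B 0)).
  move=> s; rewrite /void_event /=; split=> [[/seteqP[h _] nB]|/seteqP[h _]].
    by apply/seteqP; split=> // x [[sx|/= ->]// Bx]; apply: (h x).
  split; last by move=> B0; apply: (h 0); split=> //; right.
  by apply/seteqP; split=> // x [sx Bx]; apply: (h x); split=> //; left.
by apply: mp_and; [exact: void_measurable|exact: mp_cst].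
Qed.

(* For an almost sure shift-invariant property, the point at the origin can be
   traded for the unique point of the process in a short interval. *)
Lemma palm_transfer (X : set mconf) : measurable X ->
  (forall u s, X s -> X (shift_conf u s)) ->
  P (phi @^-1` (~` X)) = 0%E -> {ae P, forall w, X (add0 (phi w))}.
Proof.
move=> mX Xshift PX0; pose bad : set T := (add0 \o phi) @^-1` (~` X).
have mnX : measurable (~` X) by exact: measurableC.
have mbad : measurable bad.
  apply: preimage_measurable mnX.
  by apply: measurableT_comp; [exact: measurable_add0|exact: measurable_phi].
suff bad0 : P bad = 0%E by exact/(negligibleP P mbad).
have small (e : R) : 0 < e -> (P bad <= (lam * e)%:E)%E.
  move=> e0; pose A := insert 0 e @^-1` (~` X) `&` ([set: T] `*` `[0, e[%classic).
  have mA : measurable A.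
    apply: measurableI; last exact: measurableX.
    exact: preimage_measurable (measurable_insert _ _) mnX.
  have A0 : (P \x^ lebesgue_measure)%E A = 0%E.
    have := @insertion 0 e e0 (P \x^ lebesgue_measure)%E _ _ mnX.
    have -> : P (phi @^-1` (~` X) `&` single 0 e) = 0%E.
      apply/eqP; rewrite -measure_le0 -PX0; apply: le_measure; rewrite ?inE //.
      - apply: measurableI; last exact: measurable_single.
        exact: preimage_measurable measurable_phi mnX.
      - exact: preimage_measurable measurable_phi mnX.
    move=> /(_ _)/esym/eqP; rewrite mule_eq0 eqe mulf_eq0 (gt_eqF lam_gt0) /=.
    rewrite gt_eqF ?expR_gt0//= => h; apply/eqP; apply: h.
    by move=> ? ? ? ?; rewrite product_measure2E.
  have mf : measurable_fun setT (P \o ysection A) by exact: measurable_fun_ysection.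
  have /ae_eq_integral_abs : (\int[lebesgue_measure]_(u in setT) `|(P \o ysection A) u|)%E = 0%E.
    by rewrite -[RHS]A0; apply: eq_integral => u _; rewrite gee0_abs.
  move=> /(_ measurableT mf) ae0.
  have [u Iu Pu] : exists2 u : R, `[0, e[%classic u & P (ysection A u) = 0%E.
    apply: contrapT => nu.
    have : lebesgue_measure.-negligible (`[0, e[%classic : set R).
      apply: negligibleS ae0 => u Iu /= h; apply: nu; exists u => //.
      exact: h.
    move=> /negligibleP neg.
    have : lebesgue_measure (`[0, e[%classic : set R) = 0%E by apply: neg.
    by rewrite lebesgue_measure_itv /= lte_fin e0 => /eqP; rewrite sube0 eqe gt_eqF.
  have Pu' : P ((replace 0 e u \o phi) @^-1` (~` X)) = 0%E.
    rewrite -Pu; congr (P _); apply/seteqP; split=> w; rewrite /ysection /= inE.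
      by move=> h; split.
    by case.
  pose Y : set mconf := replace 0 e u @^-1` (~` X).
  have mY : measurable Y by exact: preimage_measurable (measurable_replace _ _ _) mnX.
  have PY : P ((shift_conf u \o phi) @^-1` Y) = 0%E.
    by rewrite law_shift// -comp_preimage.
  pose J : set R := `[(- u), (e - u)[%classic.
  have bJ : bounded_borel J by exact: bounded_borel_itv.
  have mV : measurable (phi @^-1` void_event J).
    by apply: preimage_measurable measurable_phi _; exact: void_measurable.
  have mYs : measurable ((shift_conf u \o phi) @^-1` Y).
    apply: preimage_measurable mY.
    by apply: measurableT_comp; [exact: measurable_shift|exact: measurable_phi].
  have sub : bad `<=` (shift_conf u \o phi) @^-1` Y `|` ~` (phi @^-1` void_event J).
    move=> w bw; have [vJ|nv] := pselect (void_event J (phi w)); last by right.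
    left; rewrite /Y /= => Xw; apply: bw.
    rewrite /bad /=.
    have -> : add0 (phi w) = shift_conf (- u) (replace 0 e u (shift_conf u (phi w))).
      apply: conf_eq; suff : Phi w `|` [set 0] =
          sh (- u) ((sh u (Phi w) `\` `[0, e[%classic) `|` [set u]) by [].
      apply/seteqP; split=> x; rewrite /sh /= opprK.
        move=> [Px|/= ->]; last by right; rewrite /= add0r.
        left; split; first by rewrite addrK.
        rewrite in_itv /= => /andP[h1 h2].
        move: vJ; rewrite /void_event /= => /seteqP[/(_ x) + _]; apply; split=> //.
        by rewrite /J /= in_itv /=; apply/andP; split; lra.
      move=> [[+ _]|/= h]; first by rewrite addrK; left.
      by right => /=; lra.
    exact: Xshift.
  apply: le_trans (le_measure _ _ _ sub) _; rewrite ?inE//.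
    by apply: measurableU => //; exact: measurableC.
  have : (P ((shift_conf u \o phi) @^-1` Y `|` ~` (phi @^-1` void_event J)) <=
      P ((shift_conf u \o phi) @^-1` Y) + P (~` (phi @^-1` void_event J)))%E.
    by apply: measureU2 => //; exact: measurableC.
  move=> /le_trans; apply; rewrite PY add0e probability_setC// void_prob//.
  have -> : vol J = e by rewrite vol_itv; lra.
  by rewrite -EFinB lee_fin; have := expR_ge1Dx (- (lam * e)); lra.
have Pf : P bad = (fine (P bad))%:E by rewrite fineK// fin_num_measure.
rewrite Pf; congr EFin; apply/eqP; rewrite eq_le fine_ge0 ?andbT//.
apply: (@archimedean_le0 _ lam) => n.
case: n => [|n]; first by rewrite mulr0 ltW.
have : (P bad <= (lam * n.+1%:R^-1)%:E)%E by apply: small; rewrite invr_gt0.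
by rewrite Pf lee_fin -ler_pdivlMr.
Qed.

Theorem palm_tame_ae : {ae P, forall w, tame (Phi w `|` [set 0])}.
Proof.
have := @palm_transfer [set s | tame (pts s)] mp_tame.
apply=> [u s|]; first exact: tame_shift.
apply: measure_negligible; last exact: tame_ae.
by apply: preimage_measurable measurable_phi _; apply: measurableC; exact: mp_tame.
Qed.

End PoissonProcess.

Unset Implicit Arguments.

Theorem mainTheorem6 (R : realType) (d : measure_display) (T : measurableType d)
    (P : probability T R) (lam : R) (Phi : T -> set R) :
  PoissonPP P lam Phi ->
  {ae P, forall w, CHN2_EFF_connected (Phi w `|` [set 0])}.
Proof.
move=> PP; apply: negligibleS (palm_tame_ae PP) => w /= nc tw; apply: nc.
apply/generic_connected/tame_generic => //.
  by apply: add0_locally_finite; exact: phi_lf PP w.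
by exists 0; right.
Qed.
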